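(* Let $\mathbb{K}$ be a field of characteristic zero and let $A$ be a commutative Noetherian $\mathbb{K}$-algebra that is either finitely generated over $\mathbb{K}$, or complete (i.e. a quotient of a formal power series ring $\mathbb{K}[[x_1,\dots,x_d]]$). Fix $f\in A$. Then the following are equivalent: 1. There exists a Bernstein–Sato polynomial for $f$. 2. $M^A[\boldsymbol{f^s}]\otimes_{\mathbb{K}[s]}\mathbb{K}(s)$ is a finitely generated $D_{A|\mathbb{K}}[s]\otimes_{\mathbb{K}[s]}\mathbb{K}(s)$-module. 3. $M^A[\boldsymbol{f^s}]\otimes_{\mathbb{K}[s]}\mathbb{K}(s)$ is generated by $\boldsymbol{f^s}$ as a $D_{A|\mathbb{K}}[s]\otimes_{\mathbb{K}[s]}\mathbb{K}(s)$-module.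
   Context: $D_{A|\mathbb{K}}$ is Grothendieck's ring of $\mathbb{K}$-linear differential operators on $A$; modules are left modules with action $\bullet$; $A_f$ is a $D_{A|\mathbb{K}}$-module via the unique extension of operators to the localization. $M^A[\boldsymbol{f^s}]=A_f[s]\boldsymbol{f^s}$ is the free rank-one $A_f[s]$-module on the formal symbol $\boldsymbol{f^s}$, with the unique $D_{A|\mathbb{K}}[s]$-module structure such that $\varphi_t(\delta\bullet v)=\delta(t)\bullet\varphi_t(v)$ for all $v$, all $\delta\in D_{A|\mathbb{K}}[s]$ and all $t\in\mathbb{Z}$, where $\varphi_t(h(s)\boldsymbol{f^s})=h(t)f^t\in A_f$. ''There exists a Bernstein–Sato polynomial for $f$'' means: there exist $\delta(s)\in D_{A|\mathbb{K}}[s]$ and a nonzero $b(s)\in\mathbb{K}[s]$ with $\delta(s)\bullet f\boldsymbol{f^s}=b(s)\boldsymbol{f^s}$ in $M^A[\boldsymbol{f^s}]$. *)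

(* Defs.v *)
From HB Require Import structures.
From mathcomp Require Import all_boot all_order all_algebra boolp zify ring.

Set Implicit Arguments.
Unset Strict Implicit.
Unset Printing Implicit Defensive.

Import Order.TTheory GRing.Theory Num.Theory.
Local Open Scope ring_scope.
Local Open Scope quotient_scope.

(* MathComp's [algType] and [{poly R}] require 1 != 0, whereas the localization
   of a ring at a nilpotent element is the zero ring (and A itself may be the
   zero algebra).  Everything below is therefore done with [pzRingType]s, a
   commutative K-algebra A being given by a ring morphism K -> A. *)

Definition pseries (R : Type) : Type := nat -> R.

Section PowerSeries.
Variable R : pzRingType.

HB.instance Definition _ := Choice.copy (pseries R) (nat -> R).

Implicit Types u v w : pseries R.

Let zerops : pseries R := fun=> 0.
Let oneps : pseries R := fun n => (n == 0%N)%:R.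
Let oppps u : pseries R := fun n => - u n.
Let addps u v : pseries R := fun n => u n + v n.
Let mulps u v : pseries R := fun n => \sum_(i < n.+1) u i * v (n - i)%N.

Let addpsA : associative addps.
Proof. by move=> u v w; apply/funext => n; rewrite /addps addrA. Qed.
Let addpsC : commutative addps.
Proof. by move=> u v; apply/funext => n; rewrite /addps addrC. Qed.
Let add0ps : left_id zerops addps.
Proof. by move=> u; apply/funext => n; rewrite /addps add0r. Qed.
Let addNps : left_inverse zerops oppps addps.
Proof. by move=> u; apply/funext => n; rewrite /addps addNr. Qed.

HB.instance Definition _ :=
  GRing.isZmodule.Build (pseries R) addpsA addpsC add0ps addNps.

Let mulps_rev u v n : mulps u v n = \sum_(i < n.+1) u (n - i)%N * v i.
Proof.
rewrite /mulps (reindex_inj rev_ord_inj) /=.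
by apply: eq_bigr => i _; rewrite (sub_ordK i).
Qed.

Let mulpsA : associative mulps.
Proof.
move=> u v w; apply/funext => i; rewrite {1}/mulps (mulps_rev (mulps u v)).
pose c j k := u j * (v (i - j - k)%N * w k).
transitivity (\sum_(j < i.+1) \sum_(k < i.+1 | (k <= i - j)%N) c j k).
  apply: eq_bigr => /= j _; rewrite mulps_rev big_distrr /=.
  by rewrite (big_ord_narrow_leq (leq_subr _ _)).
rewrite (exchange_big_dep predT) //=; apply: eq_bigr => k _.
transitivity (\sum_(j < i.+1 | (j <= i - k)%N) c j k).
  apply: eq_bigl => j; rewrite -ltnS -(ltnS j) -!subSn ?leq_ord //.
  by rewrite -subn_gt0 -(subn_gt0 j) -!subnDA addnC.
rewrite (big_ord_narrow_leq (leq_subr _ _)) /mulps big_distrl /=.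
by apply: eq_bigr => j _; rewrite /c -!subnDA addnC mulrA.
Qed.

Let mul1ps : left_id oneps mulps.
Proof.
move=> u; apply/funext => n; rewrite /mulps big_ord_recl /= mul1r subn0.
by rewrite big1 ?addr0 // => i _; rewrite mul0r.
Qed.

Let mulps1 : right_id oneps mulps.
Proof.
move=> u; apply/funext => n; rewrite mulps_rev big_ord_recl /= mulr1 subn0.
by rewrite big1 ?addr0 // => i _; rewrite mulr0.
Qed.

Let mulpsDl : left_distributive mulps +%R.
Proof.
move=> u v w; apply/funext => n; rewrite -[RHS]big_split /=.
by apply: eq_bigr => i _; rewrite -mulrDl.
Qed.

Let mulpsDr : right_distributive mulps +%R.
Proof.
move=> u v w; apply/funext => n; rewrite -[RHS]big_split /=.
by apply: eq_bigr => i _; rewrite -mulrDr.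
Qed.

HB.instance Definition _ := GRing.Zmodule_isPzRing.Build (pseries R)
  mulpsA mul1ps mulps1 mulpsDl mulpsDr.

Lemma ps0E n : (0 : pseries R) n = 0. Proof. by []. Qed.
Lemma ps1E n : (1 : pseries R) n = (n == 0%N)%:R. Proof. by []. Qed.
Lemma psNE u n : (- u) n = - u n. Proof. by []. Qed.
Lemma psDE u v n : (u + v) n = u n + v n. Proof. by []. Qed.
Lemma psME u v n : (u * v) n = \sum_(i < n.+1) u i * v (n - i)%N.
Proof. by []. Qed.
Lemma psMrE u v n : (u * v) n = \sum_(i < n.+1) u (n - i)%N * v i.
Proof. exact: mulps_rev. Qed.

Definition psC (a : R) : pseries R := fun n => if n is 0 then a else 0.

End PowerSeries.

Section ComPowerSeries.
Variable R : comPzRingType.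
Let mulpsC : commutative (@GRing.mul (pseries R)).
Proof.
by move=> u v; apply/funext => n; rewrite psME psMrE; apply: eq_bigr => i _; rewrite mulrC.
Qed.
HB.instance Definition _ :=
  GRing.PzRing_hasCommutativeMul.Build (pseries R) mulpsC.
End ComPowerSeries.

(* K[[x_1,...,x_d]], as the iterated power series ring *)
Fixpoint mpseries (K : comPzRingType) (d : nat) : comPzRingType :=
  if d is d'.+1 then pseries (mpseries K d') else K.

Fixpoint mpsC (K : comPzRingType) (d : nat) : K -> mpseries K d :=
  if d is d'.+1 then fun k => psC (mpsC d' k) else id.

(* R[s], as the subring of R[[s]] of the series with finitely many terms *)
Section Polynomials.
Variable R : pzRingType.

Definition finsupp : {pred pseries R} :=
  fun u => `[< exists N, forall n, (N <= n)%N -> u n = 0 >].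

Fact finsupp_closed : subring_closed finsupp.
Proof.
split=> [|u v|u v].
- by apply/asboolP; exists 1%N => -[].
- move=> /asboolP[N uN] /asboolP[M vM]; apply/asboolP; exists (maxn N M) => n.
  by rewrite geq_max psDE psNE => /andP[/uN-> /vM->]; rewrite subrr.
- move=> /asboolP[N uN] /asboolP[M vM]; apply/asboolP; exists (N + M)%N => n le.
  rewrite psME big1 // => i _; have [/uN->|lt] := leqP N i; first by rewrite mul0r.
  rewrite vM ?mulr0 // leq_subRL ?leq_ord // (leq_trans _ le) // leq_add2r.
  exact: ltnW.
Qed.

Record pol := Pol { coefs : pseries R; _ : coefs \in finsupp }.
HB.instance Definition _ := [isSub for coefs].
HB.instance Definition _ := [Choice of pol by <:].
HB.instance Definition _ :=
  GRing.SubChoice_isSubPzRing.Build (pseries R) finsupp pol finsupp_closed.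

Definition coef (u : pol) : nat -> R := coefs u.
Coercion coef : pol >-> Funclass.

Implicit Types u v : pol.

Lemma pol0E n : (0 : pol) n = 0. Proof. by []. Qed.
Lemma pol1E n : (1 : pol) n = (n == 0%N)%:R. Proof. by []. Qed.
Lemma polNE u n : (- u) n = - u n. Proof. by []. Qed.
Lemma polDE u v n : (u + v) n = u n + v n. Proof. by []. Qed.
Lemma polME u v n : (u * v) n = \sum_(i < n.+1) u i * v (n - i)%N.
Proof. by []. Qed.

Lemma polMrE u v n : (u * v) n = \sum_(i < n.+1) u (n - i)%N * v i.
Proof. exact: psMrE. Qed.

Lemma pol_ex u : exists N, `[< forall n, (N <= n)%N -> u n = 0 >].
Proof. by case: u => u /= /asboolP[N uN]; exists N; apply/asboolP. Qed.

Definition psize u : nat := ex_minn (pol_ex u).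

Lemma psizeP u n : (psize u <= n)%N -> u n = 0.
Proof. by rewrite /psize; case: ex_minnP => N /asboolP + _ => /[apply]. Qed.

Definition peval u (t : int) : R := \sum_(i < psize u) u i *~ (t ^+ i).

Lemma big_trunc (F : nat -> R) N M : (forall n, (N <= n)%N -> F n = 0) ->
  (N <= M)%N -> \sum_(i < M) F i = \sum_(i < N) F i.
Proof.
move=> F0 /subnK <-; elim: (M - N)%N => // k IH.
by rewrite addSn big_ord_recr /= IH F0 ?leq_addl ?addr0.
Qed.

Lemma pevalE u t N : (forall n, (N <= n)%N -> u n = 0) ->
  peval u t = \sum_(i < N) u i *~ (t ^+ i).
Proof.
move=> uN; rewrite /peval.
pose F i := u i *~ (t ^+ i).
rewrite -[RHS](@big_trunc F _ (maxn (psize u) N)) ?leq_maxr //; last first.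
  by move=> n /uN; rewrite /F => ->; rewrite mul0rz.
rewrite -[LHS](@big_trunc F _ (maxn (psize u) N)) ?leq_maxl // => n.
by move=> /psizeP; rewrite /F => ->; rewrite mul0rz.
Qed.

Lemma peval0 t : peval 0 t = 0.
Proof. by rewrite (@pevalE _ t 0) ?big_ord0. Qed.

Lemma peval1 t : peval 1 t = 1.
Proof. by rewrite (@pevalE _ t 1) ?big_ord1 // => -[]. Qed.

Lemma pevalD u v t : peval (u + v) t = peval u t + peval v t.
Proof.
set N := maxn (psize u) (psize v).
have uN n : (N <= n)%N -> u n = 0 by rewrite geq_max => /andP[/psizeP].
have vN n : (N <= n)%N -> v n = 0 by rewrite geq_max => /andP[_ /psizeP].
rewrite (pevalE t uN) (pevalE t vN) (@pevalE _ t N) => [|n le]; last first.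
  by rewrite polDE uN // vN // addr0.
by rewrite -big_split; apply: eq_bigr => i _; rewrite polDE mulrzDl.
Qed.

Lemma pevalM u v t : peval (u * v) t = peval u t * peval v t.
Proof.
pose N := (psize u + psize v)%N.
have uN n : (psize u <= n)%N -> u n = 0 by apply: psizeP.
have vN n : (psize v <= n)%N -> v n = 0 by apply: psizeP.
rewrite (@pevalE _ t N); last first.
  move=> n le; rewrite [LHS]polME big1 // => i _.
  have [/uN->|lt] := leqP (psize u) i; first by rewrite mul0r.
  rewrite vN ?mulr0 // leq_subRL ?leq_ord // (leq_trans _ le) // leq_add2r.
  exact: ltnW.
pose c i j := u i * v j *~ (t ^+ (i + j)).
transitivity (\sum_(n < N) \sum_(i < N | (i <= n)%N) c i (n - i)%N).
  apply: eq_bigr => n _; rewrite [(u * v) n]polME mulrz_suml.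
  under [RHS]eq_bigl do rewrite -ltnS.
  rewrite (big_ord_narrow (ltn_ord n : n.+1 <= N)%N) /=.
  by apply: eq_bigr => i _; rewrite /c /= subnKC // -ltnS.
rewrite (exchange_big_dep predT) //=.
pose F i := u i *~ (t ^+ i).
rewrite /peval -[\sum_(i < psize u) _](@big_trunc F _ N) ?leq_addr //; last first.
  by move=> n /uN; rewrite /F => ->; rewrite mul0rz.
rewrite big_distrl /=; apply: eq_bigr => i _.
have [/uN u0|lt] := leqP (psize u) i.
  by rewrite /F u0 mul0rz mul0r big1 // => j _; rewrite /c u0 mul0r mul0rz.
transitivity (\sum_(j < N - i) c i j).
  rewrite -(big_mkord (fun n => (i <= n)%N) (fun n => c i (n - i)%N)).
  rewrite (big_cat_nat _ (n := i)) ?(ltnW (ltn_ord i)) //=.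
  rewrite big_nat_cond big1 ?add0r; last first.
    by move=> j /andP[/andP[_ ji] ij]; rewrite leqNgt ji in ij.
  rewrite -{1}[val i]add0n big_addn big_mkord.
  rewrite big_mkcond; apply: eq_bigr => j _ /=.
  by rewrite leq_addl addnK.
rewrite (big_trunc (F := c i) (N := psize v)); first last.
- rewrite leq_subRL ?leq_add2r ?(ltnW (ltn_ord i)) //; exact: ltnW.
- by move=> n /vN v0; rewrite /c v0 mulr0 mul0rz.
rewrite big_distrr /=; apply: eq_bigr => j _.
by rewrite /c /F mulrzAl mulrzAr -mulrzA -exprD addnC.
Qed.

Lemma polP u v : (forall n, u n = v n) <-> u = v.
Proof. by split=> [uv|-> //]; apply/val_inj/funext. Qed.

Lemma pol_psub_proof (F : nat -> R) N :
  (fun n => if (n < N)%N then F n else 0) \in finsupp.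
Proof. by apply/asboolP; exists N => n; rewrite leqNgt; case: ifP. Qed.
Definition mkpol (N : nat) (F : nat -> R) : pol := Pol (pol_psub_proof F N).

Lemma peval_mkpol N F t : peval (mkpol N F) t = \sum_(i < N) F i *~ (t ^+ i).
Proof.
rewrite (@pevalE _ t N) => [|n /=]; last by rewrite leqNgt; case: ifP.
by apply: eq_bigr => i _ /=; rewrite ltn_ord.
Qed.

Definition polC (a : R) : pol := mkpol 1 (fun=> a).

Lemma peval_polC a t : peval (polC a) t = a.
Proof. by rewrite peval_mkpol big_ord1. Qed.

End Polynomials.

Section ConstPoly.
Variables (K : nzRingType) (R : pzRingType) (i : {rmorphism K -> R}).

Definition poly_in (p : {poly K}) : pol R := mkpol (size p) (fun n => i p`_n).

Lemma poly_inE p n : poly_in p n = i p`_n.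
Proof.
rewrite /poly_in /=; case: ltnP => // le.
by rewrite nth_default // rmorph0.
Qed.

Let poly_in_additive : zmod_morphism poly_in.
Proof.
move=> p q; apply/polP => n.
by rewrite polDE polNE !poly_inE coefB rmorphB.
Qed.
HB.instance Definition _ := GRing.isZmodMorphism.Build {poly K} (pol R) poly_in poly_in_additive.

Let poly_in_mul : monoid_morphism poly_in.
Proof.
split=> [|p q]; apply/polP => n.
  by rewrite poly_inE coef1 rmorph_nat.
rewrite [RHS]polME poly_inE coefM rmorph_sum.
by apply: eq_bigr => j _; rewrite rmorphM !poly_inE.
Qed.
HB.instance Definition _ := GRing.isMonoidMorphism.Build {poly K} (pol R) poly_in poly_in_mul.

End ConstPoly.

(* The localization A_f: [frac a n] is a / f^n. *)
Section Localization.
Variables (A : comPzRingType) (f : A).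

Definition loc_eq (x y : A * nat) : bool :=
  `[< exists k, f ^+ k * (f ^+ y.2 * x.1) = f ^+ k * (f ^+ x.2 * y.1) >].

Let loc_eq_refl : reflexive loc_eq.
Proof. by move=> x; apply/asboolP; exists 0%N. Qed.

Let loc_eq_sym : symmetric loc_eq.
Proof. by move=> x y; apply/asboolP/asboolP => -[k e]; exists k. Qed.

Let loc_eq_trans : transitive loc_eq.
Proof.
move=> [b m] [a n] [c p] /asboolP[k /= ek] /asboolP[l /= el].
apply/asboolP; exists (k + l + m)%N => /=.
transitivity (f ^+ l * f ^+ p * (f ^+ k * (f ^+ m * a))).
  by rewrite !exprD !mulrA; congr (_ * a); rewrite -!exprD; congr (_ ^+ _); lia.
rewrite ek; transitivity (f ^+ k * f ^+ n * (f ^+ l * (f ^+ p * b))).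
  by rewrite !mulrA; congr (_ * b); rewrite -!exprD; congr (_ ^+ _); lia.
by rewrite el !mulrA; congr (_ * c); rewrite -!exprD; congr (_ ^+ _); lia.
Qed.

Canonical loc_equiv := EquivRel loc_eq loc_eq_refl loc_eq_sym loc_eq_trans.
Definition loc := {eq_quot loc_eq}.
HB.instance Definition _ := Choice.on loc.

Definition frac (a : A) (n : nat) : loc := \pi_loc (a, n).

Lemma frac_eqP a n b m :
  frac a n = frac b m <-> exists k, f ^+ k * (f ^+ m * a) = f ^+ k * (f ^+ n * b).
Proof.
split=> [/(@eqmodP _ loc_equiv)/asboolP //|h].
by apply/(@eqmodP _ loc_equiv)/asboolP.
Qed.

Lemma loc_ind (P : loc -> Prop) : (forall a n, P (frac a n)) -> forall x, P x.
Proof. by move=> h; apply: quotW => -[a n]; apply: h. Qed.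

Let num (x : loc) : A := (repr x).1.
Let den (x : loc) : nat := (repr x).2.

Let fracK x : frac (num x) (den x) = x.
Proof. by rewrite /frac /num /den -surjective_pairing reprK. Qed.

Let addl x y :=
  frac (f ^+ den y * num x + f ^+ den x * num y) (den x + den y).
Let mull x y := frac (num x * num y) (den x + den y).
Let oppl x := frac (- num x) (den x).

Let addlE a n b m :
  addl (frac a n) (frac b m) = frac (f ^+ m * a + f ^+ n * b) (n + m).
Proof.
rewrite /addl; have /frac_eqP[k] := fracK (frac a n).
have /frac_eqP[l] := fracK (frac b m).
move: (num (frac a n)) (den (frac a n)) (num (frac b m)) (den (frac b m)).
move=> a' n' b' m' eb ea.
apply/frac_eqP; exists (k + l)%N; rewrite !mulrDr; congr (_ + _).
  transitivity (f ^+ l * f ^+ m * f ^+ m' * (f ^+ k * (f ^+ n * a'))).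
    by rewrite !exprD; ring.
  by rewrite ea !exprD; ring.
transitivity (f ^+ k * f ^+ n * f ^+ n' * (f ^+ l * (f ^+ m * b'))).
  by rewrite !exprD; ring.
by rewrite eb !exprD; ring.
Qed.

Let mullE a n b m : mull (frac a n) (frac b m) = frac (a * b) (n + m).
Proof.
rewrite /mull; have /frac_eqP[k] := fracK (frac a n).
have /frac_eqP[l] := fracK (frac b m).
move: (num (frac a n)) (den (frac a n)) (num (frac b m)) (den (frac b m)).
move=> a' n' b' m' eb ea.
apply/frac_eqP; exists (k + l)%N.
transitivity ((f ^+ k * (f ^+ n * a')) * (f ^+ l * (f ^+ m * b'))).
  by rewrite !exprD; ring.
by rewrite ea eb !exprD; ring.
Qed.

Let opplE a n : oppl (frac a n) = frac (- a) n.
Proof.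
rewrite /oppl; have /frac_eqP[k] := fracK (frac a n).
by move=> e; apply/frac_eqP; exists k; rewrite !mulrN e.
Qed.

Let fracS a b n m : f ^+ m * a = f ^+ n * b -> frac a n = frac b m.
Proof. by move=> e; apply/frac_eqP; exists 0%N; rewrite e. Qed.

Let addlA : associative addl.
Proof.
elim/loc_ind=> a n; elim/loc_ind=> b m; elim/loc_ind=> c p.
by rewrite !addlE; apply: fracS; rewrite !exprD; ring.
Qed.
Let addlC : commutative addl.
Proof.
by elim/loc_ind=> a n; elim/loc_ind=> b m; rewrite !addlE; apply: fracS; rewrite !exprD; ring.
Qed.
Let add0l : left_id (frac 0 0) addl.
Proof.
by elim/loc_ind=> a n; rewrite !addlE; apply: fracS; rewrite !exprD; ring.
Qed.
Let addNl : left_inverse (frac 0 0) oppl addl.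
Proof.
by elim/loc_ind=> a n; rewrite !opplE !addlE; apply: fracS; rewrite !exprD; ring.
Qed.
HB.instance Definition _ := GRing.isZmodule.Build loc addlA addlC add0l addNl.

Let mullA : associative mull.
Proof.
elim/loc_ind=> a n; elim/loc_ind=> b m; elim/loc_ind=> c p.
by rewrite !mullE; apply: fracS; rewrite !exprD; ring.
Qed.
Let mullC : commutative mull.
Proof.
by elim/loc_ind=> a n; elim/loc_ind=> b m; rewrite !mullE; apply: fracS; rewrite !exprD; ring.
Qed.
Let mul1l : left_id (frac 1 0) mull.
Proof. by elim/loc_ind=> a n; rewrite !mullE mul1r. Qed.
Let mullDl : left_distributive mull +%R.
Proof.
elim/loc_ind=> a n; elim/loc_ind=> b m; elim/loc_ind=> c p.
rewrite -![_ + _]/(addl _ _) !(mullE, addlE).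
by apply: fracS; rewrite !exprD; ring.
Qed.
HB.instance Definition _ :=
  GRing.Zmodule_isComPzRing.Build loc mullA mullC mul1l mullDl.

Lemma fracD a n b m : frac a n + frac b m = frac (f ^+ m * a + f ^+ n * b) (n + m).
Proof. exact: addlE. Qed.
Lemma fracM a n b m : frac a n * frac b m = frac (a * b) (n + m).
Proof. exact: mullE. Qed.
Lemma fracN a n : - frac a n = frac (- a) n.
Proof. exact: opplE. Qed.

Definition loc_in (a : A) : loc := frac a 0.

Let loc_in_additive : zmod_morphism loc_in.
Proof.
by move=> a b; rewrite /loc_in fracN fracD; apply: fracS; rewrite !expr0; ring.
Qed.
HB.instance Definition _ := GRing.isZmodMorphism.Build A loc loc_in loc_in_additive.
Let loc_in_mul : monoid_morphism loc_in.
Proof. by split=> [|a b]; rewrite /loc_in ?fracM. Qed.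
HB.instance Definition _ := GRing.isMonoidMorphism.Build A loc loc_in loc_in_mul.

Lemma fracE a n : frac a n = loc_in a * frac 1 n.
Proof. by rewrite fracM mulr1. Qed.

Lemma fracV n : loc_in (f ^+ n) * frac 1 n = 1.
Proof. by rewrite fracM; apply: fracS; rewrite !exprD; ring. Qed.

Lemma locfV x : loc_in f * (frac 1 1 * x) = x.
Proof. by rewrite mulrA (fracV 1) mul1r. Qed.

(* f^t for an integer t *)
Definition fexp (t : int) : loc :=
  match t with Posz n => frac (f ^+ n) 0 | Negz n => frac 1 n.+1 end.

Lemma fexp0 : fexp 0 = 1. Proof. by []. Qed.

Lemma fexpS t : fexp (t + 1) = loc_in f * fexp t.
Proof.
case: t => [n|[|n]].
- by rewrite -PoszD addn1 /= fracM exprS.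
- by rewrite /= fracM; apply: fracS; rewrite !exprS; ring.
- have -> : Negz n.+1 + 1 = Negz n by rewrite !NegzE; lia.
  by rewrite /= fracM; apply: fracS; rewrite !exprS; ring.
Qed.

Lemma fexpNl t : fexp (- t) * fexp t = 1.
Proof.
case: t => [[|n]|n]; first by rewrite oppr0 !fexp0 mulr1.
  by rewrite -NegzE mulrC [LHS]fracV.
by rewrite NegzE opprK [LHS]fracV.
Qed.

End Localization.

(* Grothendieck's ring D_{A|K} of K-linear differential operators, the
   K-algebra structure of A being given by i : K -> A. *)
Section DiffOp.
Variables (K A : comPzRingType) (i : {rmorphism K -> A}).
Implicit Types (d e : A -> A) (a b x y : A).

Definition commutator d a : A -> A := fun x => d (a * x) - a * d x.

Definition klinear d := forall k x y, d (i k * x + y) = i k * d x + d y.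

Fixpoint is_diffop (n : nat) d : Prop :=
  klinear d /\
  match n with
  | 0 => forall a x, d (a * x) = a * d x
  | n'.+1 => forall a, is_diffop n' (commutator d a)
  end.

Lemma diffop_klin n d : is_diffop n d -> klinear d.
Proof. by case: n => [|n] []. Qed.

Lemma klinD d x y : klinear d -> d (x + y) = d x + d y.
Proof. by move=> /(_ 1 x y); rewrite rmorph1 !mul1r. Qed.

Lemma klin0 d : klinear d -> d 0 = 0.
Proof. by move=> dl; apply: (addIr (d 0)); rewrite -(klinD _ _ dl) !add0r. Qed.

Lemma klinN d x : klinear d -> d (- x) = - d x.
Proof.
by move=> dl; apply/eqP; rewrite -addr_eq0 -(klinD _ _ dl) addNr (klin0 dl).
Qed.

Lemma klinB d x y : klinear d -> d (x - y) = d x - d y.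
Proof. by move=> dl; rewrite (klinD _ _ dl) (klinN _ dl). Qed.

Lemma klinZ d k x : klinear d -> d (i k * x) = i k * d x.
Proof. by move=> dl; rewrite -[i k * x]addr0 dl (klin0 dl) addr0. Qed.

Lemma is_diffopD n d e :
  is_diffop n d -> is_diffop n e -> is_diffop n (fun x => d x + e x).
Proof.
elim: n d e => [|n IH] d e [dl dn] [el en]; split.
- by move=> k x y; rewrite dl el mulrDr addrACA.
- by move=> a x; rewrite dn en mulrDr.
- by move=> k x y; rewrite dl el mulrDr addrACA.
move=> a; have -> : commutator (fun x => d x + e x) a =
   (fun x => commutator d a x + commutator e a x).
  by apply/funext => x; rewrite /commutator mulrDr opprD addrACA.
exact: IH (dn a) (en a).
Qed.

Lemma is_diffopN n d : is_diffop n d -> is_diffop n (fun x => - d x).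
Proof.
elim: n d => [|n IH] d [dl dn]; split.
- by move=> k x y; rewrite dl opprD mulrN.
- by move=> a x; rewrite dn mulrN.
- by move=> k x y; rewrite dl opprD mulrN.
move=> a; have -> : commutator (fun x => - d x) a = (fun x => - commutator d a x).
  by apply/funext => x; rewrite /commutator mulrN opprB opprK addrC.
exact: IH (dn a).
Qed.

Lemma is_diffopS n d : is_diffop n d -> is_diffop n.+1 d.
Proof.
elim: n d => [|n IH] d [dl dn]; split=> // a; last exact: IH (dn a).
have -> : commutator d a = fun=> 0.
  by apply/funext => x; rewrite /commutator dn subrr.
by split=> [k x y|b x]; rewrite ?mulr0 ?addr0.
Qed.

Lemma is_diffop_leq m n d : (m <= n)%N -> is_diffop m d -> is_diffop n d.
Proof. by move=> /subnK <-; elim: (n - m)%N => //= k IH /IH /is_diffopS. Qed.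

Lemma is_diffop_mul n a : is_diffop n (fun x => a * x).
Proof.
apply: (@is_diffop_leq 0) => //; split=> [k x y|b x]; last by rewrite mulrCA.
by rewrite mulrDr mulrCA.
Qed.

Lemma klinear_comp d e : klinear d -> klinear e -> klinear (d \o e).
Proof. by move=> dl el k x y; rewrite /= el dl. Qed.

Lemma commutator_comp d e a : klinear d -> commutator (d \o e) a =
  (fun x => (d \o commutator e a) x + (commutator d a \o e) x).
Proof.
by move=> dl; apply/funext => x; rewrite /commutator /= (klinB _ _ dl) addrA subrK.
Qed.

Lemma is_diffop_comp m n d e :
  is_diffop m d -> is_diffop n e -> is_diffop (m + n) (d \o e).
Proof.
elim: m n d e => [|m IHm] n d e.
  move=> [dl d0]; elim: n e => [|n IHn] e [el en]; split; try exact: klinear_comp.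
    by move=> a x; rewrite /= en d0.
  move=> a; rewrite commutator_comp //; apply: is_diffopD; first exact: IHn (en a).
  have -> : commutator d a \o e = fun x => 0 * x.
    by apply/funext => x; rewrite /commutator /= d0 subrr mul0r.
  exact: is_diffop_mul.
move=> [dl dm]; elim: n e => [|n IHn] e en; split.
- by apply: klinear_comp => //; case: en.
- rewrite addn0 => a; rewrite commutator_comp //; apply: is_diffopD.
    have -> : d \o commutator e a = fun x => 0 * x.
      by apply/funext => x; rewrite /commutator /= en.2 subrr mul0r (klin0 dl).
    exact: is_diffop_mul.
  by rewrite -[m]addn0; apply: IHm (dm a) en.
- by apply: klinear_comp => //; case: en.
move=> a; rewrite commutator_comp //; apply: is_diffopD.
  by rewrite addnS; apply: IHn; apply: en.2.
exact: IHm (dm a) en.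
Qed.

Definition diffop_pred : {pred A -> A} := fun d => `[< exists n, is_diffop n d >].

Record diffop := DiffOp { dop :> A -> A; _ : dop \in diffop_pred }.
HB.instance Definition _ := [isSub for dop].
HB.instance Definition _ := [Choice of diffop by <:].

Lemma diffopP (d : diffop) : exists n, is_diffop n d.
Proof. by case: d => d dP; apply/asboolP. Qed.

Lemma diffop_linear (d : diffop) : klinear d.
Proof. by have [n /diffop_klin] := diffopP d. Qed.

Lemma mk_diffop_proof n d : is_diffop n d -> d \in diffop_pred.
Proof. by move=> dn; apply/asboolP; exists n. Qed.
Definition mk_diffop n d (dn : is_diffop n d) := DiffOp (mk_diffop_proof dn).

Lemma diffop_ext (d e : diffop) : (forall x, d x = e x) -> d = e.
Proof. by move=> de; apply/val_inj/funext. Qed.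

Let addP (d e : diffop) : (fun x => d x + e x) \in diffop_pred.
Proof.
have [[m dm] [n en]] := (diffopP d, diffopP e).
apply: (@mk_diffop_proof (maxn m n)); apply: is_diffopD.
  by apply: is_diffop_leq dm; apply: leq_maxl.
by apply: is_diffop_leq en; apply: leq_maxr.
Qed.
Let oppP (d : diffop) : (fun x => - d x) \in diffop_pred.
Proof. by have [n dn] := diffopP d; apply/mk_diffop_proof/is_diffopN/dn. Qed.
Let mulP (d e : diffop) : (d \o e) \in diffop_pred.
Proof.
have [[m dm] [n en]] := (diffopP d, diffopP e).
exact: mk_diffop_proof (is_diffop_comp dm en).
Qed.

Definition mulop (a : A) : diffop := mk_diffop (is_diffop_mul 0 a).

Let addd (d e : diffop) : diffop := DiffOp (addP d e).
Let oppd (d : diffop) : diffop := DiffOp (oppP d).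
Let muld (d e : diffop) : diffop := DiffOp (mulP d e).

Let adddA : associative addd.
Proof. by move=> d e g; apply: diffop_ext => x; apply: addrA. Qed.
Let adddC : commutative addd.
Proof. by move=> d e; apply: diffop_ext => x; apply: addrC. Qed.
Let add0d : left_id (mulop 0) addd.
Proof. by move=> d; apply: diffop_ext => x /=; rewrite mul0r add0r. Qed.
Let addNd : left_inverse (mulop 0) oppd addd.
Proof. by move=> d; apply: diffop_ext => x /=; rewrite mul0r addNr. Qed.
HB.instance Definition _ := GRing.isZmodule.Build diffop adddA adddC add0d addNd.

Let muldA : associative muld.
Proof. by move=> d e g; apply: diffop_ext. Qed.
Let mul1d : left_id (mulop 1) muld.
Proof. by move=> d; apply: diffop_ext => x /=; rewrite mul1r. Qed.
Let muld1 : right_id (mulop 1) muld.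
Proof. by move=> d; apply: diffop_ext => x /=; rewrite mul1r. Qed.
Let muldDl : left_distributive muld +%R.
Proof. by move=> d e g; apply: diffop_ext. Qed.
Let muldDr : right_distributive muld +%R.
Proof.
by move=> d e g; apply: diffop_ext => x /=; apply/klinD/diffop_linear.
Qed.
HB.instance Definition _ := GRing.Zmodule_isPzRing.Build diffop
  muldA mul1d muld1 muldDl muldDr.

Lemma diffop0E x : (0 : diffop) x = 0. Proof. exact: mul0r. Qed.
Lemma diffop1E x : (1 : diffop) x = x. Proof. exact: mul1r. Qed.
Lemma diffopDE (d e : diffop) x : (d + e) x = d x + e x. Proof. by []. Qed.
Lemma diffopNE (d : diffop) x : (- d) x = - d x. Proof. by []. Qed.
Lemma diffopME (d e : diffop) x : (d * e) x = d (e x). Proof. by []. Qed.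

Definition diffop_in (k : K) : diffop := mulop (i k).

Let diffop_in_zmod : zmod_morphism diffop_in.
Proof. by move=> k l; apply: diffop_ext => x /=; rewrite rmorphB mulrBl. Qed.
HB.instance Definition _ :=
  GRing.isZmodMorphism.Build K diffop diffop_in diffop_in_zmod.
Let diffop_in_monoid : monoid_morphism diffop_in.
Proof.
split=> [|k l]; apply: diffop_ext => x /=; first by rewrite rmorph1.
by rewrite rmorphM mulrA.
Qed.
HB.instance Definition _ :=
  GRing.isMonoidMorphism.Build K diffop diffop_in diffop_in_monoid.

Lemma diffop_in_central k (d : diffop) : diffop_in k * d = d * diffop_in k.
Proof. by apply: diffop_ext => x /=; rewrite (klinZ _ _ (@diffop_linear d)). Qed.

End DiffOp.

Section Extension.
Variables (K A : comPzRingType) (i : {rmorphism K -> A}) (f : A).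

Local Notation Af := (loc f).
Local Notation inA := (@loc_in A f).

Definition loc_alg (k : K) : Af := inA (i k).
HB.instance Definition _ := GRing.RMorphism.copy loc_alg (@loc_in A f \o i).

Lemma locf_inj (x y : Af) : inA f * x = inA f * y -> x = y.
Proof.
move=> e; have h z : frac f 1 1 * (inA f * z) = z.
  by rewrite mulrCA locfV.
by rewrite -(h x) e h.
Qed.

Lemma fracfS a n : inA f * frac f a n.+1 = frac f a n.
Proof. by rewrite fracM; apply/frac_eqP; exists 0%N; rewrite exprS; ring. Qed.

Lemma ext_uniq n (d : Af -> Af) : is_diffop loc_alg n d ->
  (forall a, d (inA a) = 0) -> forall x, d x = 0.
Proof.
elim: n d => [|n IH] d dn d0.
  elim/loc_ind=> a; elim=> [|k IHk]; first exact: d0.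
  by apply: locf_inj; rewrite -(dn.2 (inA f)) fracfS IHk mulr0.
have c0 x : commutator d (inA f) x = 0.
  apply: IH => [|a]; first exact: dn.2.
  by rewrite /commutator -rmorphM !d0 mulr0 subrr.
elim/loc_ind=> a; elim=> [|k IHk]; first exact: d0.
apply: locf_inj; have /eqP := c0 (frac f a k.+1).
by rewrite /commutator fracfS IHk sub0r oppr_eq0 mulr0 => /eqP.
Qed.

Lemma ext_uniq2 n (d e : Af -> Af) : is_diffop loc_alg n d ->
  is_diffop loc_alg n e -> (forall a, d (inA a) = e (inA a)) -> d = e.
Proof.
move=> dn en de; apply/funext => x; apply/eqP; rewrite -subr_eq0; apply/eqP.
apply: (@ext_uniq n (fun x => d x + (- e x))) => [|a]; last by rewrite de subrr.
by apply: is_diffopD => //; apply: is_diffopN.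
Qed.

Lemma ext_solve (d : A -> A) (e : Af -> Af) :
  klinear i d -> (forall a, e (inA a) = inA (d (f * a) - f * d a)) ->
  exists d' : Af -> Af, (forall a, d' (inA a) = inA (d a)) /\
     forall x, inA f * d' x + e x = d' (inA f * x).
Proof.
move=> dl ed.
pose g := fix g a n {struct n} : Af :=
  if n is n'.+1 then frac f 1 1 * (g a n' - e (frac f a n)) else inA (d a).
have gS a n : inA f * g a n.+1 + e (frac f a n.+1) = g a n.
  by rewrite /= locfV subrK.
have gf a n : g (f * a) n = inA f * g a n + e (frac f a n).
  elim: n => [|n IHn].
    by rewrite /= ed rmorphB rmorphM addrC subrK.
  rewrite gS; apply: locf_inj; rewrite /= locfV IHn.
  have -> : frac f (f * a) n.+1 = frac f a n.
    by apply/frac_eqP; exists 0%N; rewrite exprS; ring.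
  by rewrite addrK.
have gfS a n : g (f * a) n.+1 = g a n by rewrite gf gS.
have gk k a n : g (f ^+ k * a) (k + n)%N = g a n.
  by elim: k => [|k IHk]; rewrite ?expr0 ?mul1r // exprS -mulrA addSn gfS.
have gE a n b m : frac f a n = frac f b m -> g a n = g b m.
  case/frac_eqP => k e0.
  rewrite -(gk (k + m)%N) -[RHS](gk (k + n)%N).
  by rewrite !exprD -!mulrA e0; congr (g _ _); lia.
have gG a n : g (repr (frac f a n)).1 (repr (frac f a n)).2 = g a n.
  by apply: gE; rewrite /frac -surjective_pairing reprK.
exists (fun x => g (repr x).1 (repr x).2); split=> [a|]; first by rewrite gG.
by elim/loc_ind=> a n; rewrite fracM !gG gf.
Qed.

Lemma ext_exists n (d : A -> A) : is_diffop i n d ->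
  exists2 d' : Af -> Af, is_diffop loc_alg n d' & forall a, d' (inA a) = inA (d a).
Proof.
have klin (d0 : A -> A) (d' e' : Af -> Af) : klinear i d0 -> klinear loc_alg e' ->
    (forall a, d' (inA a) = inA (d0 a)) ->
    (forall x, inA f * d' x + e' x = d' (inA f * x)) -> klinear loc_alg d'.
  move=> dl el d'A d'f k x y.
  suff h n0 a b : d' (loc_alg k * frac f a n0 + frac f b n0) =
      loc_alg k * d' (frac f a n0) + d' (frac f b n0).
    elim/loc_ind: x => a m; elim/loc_ind: y => b p.
    have := h (m + p)%N (f ^+ p * a) (f ^+ m * b).
    have -> : frac f (f ^+ p * a) (m + p) = frac f a m.
      by apply/frac_eqP; exists 0%N; rewrite !exprD; ring.
    have -> // : frac f (f ^+ m * b) (m + p) = frac f b p.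
    by apply/frac_eqP; exists 0%N; rewrite !exprD; ring.
  elim: n0 a b => [|n0 IH] a b.
    rewrite -[loc_alg k]/(inA (i k)) -[frac f a 0]/(inA a) -[frac f b 0]/(inA b).
    by rewrite -rmorphM -rmorphD !d'A dl rmorphD rmorphM.
  apply: locf_inj; apply: (addIr (e' (loc_alg k * frac f a n0.+1 + frac f b n0.+1))).
  rewrite d'f mulrDr mulrCA !fracfS IH el.
  have := d'f (frac f a n0.+1); have := d'f (frac f b n0.+1).
  by rewrite !fracfS => <- <-; ring.
elim: n d => [|n IH] d dn.
  exists (fun x => inA (d 1) * x); first exact: is_diffop_mul.
  by move=> a; rewrite -rmorphM mulrC -dn.2 mulr1.
have [e' e'n e'A] := IH _ (dn.2 f).
have [d' [d'A d'f]] := ext_solve (diffop_klin dn) e'A.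
have d'l : klinear loc_alg d' := klin _ _ _ (diffop_klin dn) (diffop_klin e'n) d'A d'f.
exists d' => //; split=> // g.
have cb b : is_diffop loc_alg n (commutator d' (inA b)).
  have [c' c'n c'A] := IH _ (dn.2 b).
  suff -> : commutator d' (inA b) = c' by [].
  have comm : commutator c' (inA f) = commutator e' (inA b).
    apply: (@ext_uniq2 n.+1) => [||a].
    - have := is_diffop_comp c'n (@is_diffop_mul _ _ loc_alg 0 (inA f)).
      rewrite addn0 => h; apply: is_diffopD; first exact: is_diffopS.
      apply: is_diffopN; apply: is_diffopS.
      exact: (is_diffop_comp (@is_diffop_mul _ _ loc_alg 0 (inA f)) c'n).
    - have := is_diffop_comp e'n (@is_diffop_mul _ _ loc_alg 0 (inA b)).
      rewrite addn0 => h; apply: is_diffopD; first exact: is_diffopS.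
      apply: is_diffopN; apply: is_diffopS.
      exact: (is_diffop_comp (@is_diffop_mul _ _ loc_alg 0 (inA b)) e'n).
    rewrite /commutator -!rmorphM !c'A !e'A -!rmorphM -!rmorphB; congr (inA _).
    by rewrite /commutator !(mulrCA b f); ring.
  apply/funext; elim/loc_ind=> a; elim=> [|m IHm].
    by rewrite /commutator -rmorphM !d'A c'A -rmorphM -rmorphB.
  apply: locf_inj; set y := frac f a m.+1.
  have xy : inA f * y = frac f a m by rewrite fracfS.
  have /(congr1 (fun h => h y)) := comm; rewrite /commutator xy -IHm => ce.
  have -> : inA f * c' y = commutator d' (inA b) (frac f a m) - (commutator e' (inA b)) y.
    by rewrite /commutator in ce *; rewrite -ce; ring.
  have := d'f (inA b * y); have := d'f y.
  rewrite /commutator mulrCA xy => <- <-; ring.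
elim/loc_ind: g => b m; elim: m b => [|m IHm] b; first exact: cb.
set u := frac f b m.+1.
have -> : commutator d' u = (fun x => frac f 1 1 * x) \o
    (fun x => commutator d' (frac f b m) x + - (e' \o (fun x => u * x)) x).
  apply/funext => x; apply: locf_inj.
  rewrite /= locfV /commutator -(fracfS b m) -!mulrA -d'f -/u; ring.
apply: (is_diffop_comp (is_diffop_mul _ 0 _)).
apply: is_diffopD; first exact: IHm.
apply: is_diffopN; rewrite -[n]addn0.
exact: is_diffop_comp e'n (is_diffop_mul _ 0 _).
Qed.

Lemma diffop_ext_ex (d : diffop i) :
  exists d' : diffop loc_alg, forall a, d' (inA a) = inA (d a).
Proof.
have [n dn] := diffopP d; have [d' d'n d'A] := ext_exists dn.
by exists (mk_diffop d'n).
Qed.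

(* the extension of d to a differential operator on A_f *)
Definition extop (d : diffop i) : diffop loc_alg := sval (cid (diffop_ext_ex d)).

Lemma extopE d a : extop d (inA a) = inA (d a).
Proof. by rewrite /extop; case: cid => /= d' ->. Qed.

Lemma extop_unique (d : diffop i) (d' : diffop loc_alg) :
  (forall a, d' (inA a) = inA (d a)) -> d' = extop d.
Proof.
move=> d'A; have [[m d'm] [n en]] := (diffopP d', diffopP (extop d)).
apply: diffop_ext => x; have := @ext_uniq2 (maxn m n) d' (extop d).
move=> -> // => [||a]; last by rewrite d'A extopE.
  by apply: is_diffop_leq d'm; apply: leq_maxl.
by apply: is_diffop_leq en; apply: leq_maxr.
Qed.

Lemma extopD d e : extop (d + e) = extop d + extop e.
Proof.
by apply/esym/extop_unique => a; rewrite diffopDE !extopE -rmorphD.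
Qed.

Lemma extopM d e : extop (d * e) = extop d * extop e.
Proof. by apply/esym/extop_unique => a; rewrite diffopME !extopE. Qed.

Lemma extop_mul b : extop (mulop i b) = mulop loc_alg (inA b).
Proof. by apply/esym/extop_unique => a; rewrite /= -rmorphM. Qed.

Lemma extop1 : extop 1 = 1.
Proof. by apply/esym/extop_unique => a; rewrite !diffop1E. Qed.

Lemma extop0 : extop 0 = 0.
Proof. by apply/esym/extop_unique => a; rewrite !diffop0E rmorph0. Qed.

Definition Df_act (d : diffop i) (x : Af) : Af := extop d x.

Let Df_actA d e x : Df_act d (Df_act e x) = Df_act (d * e) x.
Proof. by rewrite /Df_act extopM. Qed.
Let Df_act1 : left_id 1 Df_act.
Proof. by move=> x; rewrite /Df_act extop1 diffop1E. Qed.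
Let Df_actDr : right_distributive Df_act +%R.
Proof. by move=> d x y; apply/klinD/diffop_linear. Qed.
Let Df_actDl v : {morph Df_act^~ v : a b / a + b}.
Proof. by move=> d e; rewrite /Df_act extopD. Qed.
HB.instance Definition _ :=
  GRing.Zmodule_isLmodule.Build (diffop i) Af Df_actA Df_act1 Df_actDr Df_actDl.

Lemma Df_in d a : d *: inA a = inA (d a). Proof. exact: extopE. Qed.

End Extension.

(* M^A[f^s]: the element h(s) f^s is represented by h in A_f[s]. *)
Section Mfs.
Variables (K : fieldType) (charK : [pchar K] =i pred0).
Variables (A : comPzRingType) (i : {rmorphism K -> A}) (f : A).

Local Notation Af := (loc f).
Local Notation D := (diffop i).
Local Notation "a %:A_f" := (@loc_in A f a) (at level 2).
Implicit Types (c : nat -> Af) (g : int -> Af).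


Let natK n : (n.+1%:R : K) != 0.
Proof. by move/pcharf0P: charK => ->. Qed.

Let divn_ex n (x : Af) : exists y, y *+ n.+1 = x.
Proof.
exists (loc_alg i f (n.+1%:R^-1) * x).
rewrite -[LHS]mulr_natl mulrA -(rmorph_nat (loc_alg i f)) -rmorphM.
by rewrite mulfV ?natK // rmorph1 mul1r.
Qed.

Let mulrn_eq0l n (x : Af) : x *+ n.+1 = 0 -> x = 0.
Proof.
rewrite -mulr_natl -(rmorph_nat (loc_alg i f)) => e.
by rewrite -[x]mul1r -(rmorph1 (loc_alg i f)) -(mulVf (natK n)) rmorphM -mulrA e mulr0.
Qed.

Let pf g := exists p : pol Af, forall t, g t = peval p t.

Let binomS (t : int) j :
  (t + 1) ^+ j - t ^+ j = \sum_(k < j) (t ^+ k) *+ 'C(j, k).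
Proof.
rewrite [t + 1]addrC exprDn big_ord_recr /= subnn expr0 mul1r binn mulr1n addrK.
by apply: eq_bigr => k _; rewrite expr1n mul1r.
Qed.

Let diff_pf n c g :
  (forall t, g (t + 1) - g t = \sum_(j < n) c j *~ (t ^+ j)) -> pf g.
Proof.
elim: n c g => [|n IH] c g gd.
  exists (polC (g 0)) => t; rewrite peval_polC.
  have gS u : g (u + 1) = g u by apply/eqP; rewrite -subr_eq0 gd big_ord0.
  elim: t => // n IHn; first by rewrite -addn1 PoszD gS.
  by rewrite -gS -addn1 PoszD opprD addrNK.
have [e ec] := divn_ex n (c n).
pose q := mkpol n.+2 (fun j => if j == n.+1 then e else 0).
have qE t : peval q t = e *~ (t ^+ n.+1).
  rewrite peval_mkpol big_ord_recr /= eqxx big1 ?add0r // => j _.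
  by rewrite (ltn_eqF (ltn_ord j)) mul0rz.
have [|p gp] := IH (fun j => c j - e *+ 'C(n.+1, j)) (fun t => g t - peval q t).
  move=> t; rewrite opprB addrACA [X in _ + X]addrC addrACA gd -opprB.
  rewrite !qE -mulrzBr binomS mulrz_sumr big_ord_recr [X in _ - X]big_ord_recr /=.
  have mz (z : int) m : e *~ (z *+ m) = e *+ m *~ z.
    by rewrite -mulr_natl mulrzA natz -pmulrn.
  rewrite opprD addrACA mz binSn ec subrr addr0 -sumrB.
  by apply: eq_bigr => j _; rewrite mz mulrzBl.
exists (p + q) => t; rewrite pevalD -gp subrK //.
Qed.

Let pfD g h : pf g -> pf h -> pf (fun t => g t + h t).
Proof. by move=> [p gp] [q hq]; exists (p + q) => t; rewrite pevalD gp hq. Qed.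

Let pfM (x : Af) g : pf g -> pf (fun t => x * g t).
Proof. by move=> [p gp]; exists (polC x * p) => t; rewrite pevalM peval_polC gp. Qed.

Let pfX g k : pf g -> pf (fun t => g t *~ (t ^+ k)).
Proof.
move=> [p gp]; exists (p * mkpol k.+1 (fun j => (j == k)%:R)) => t.
rewrite pevalM peval_mkpol gp big_ord_recr /= eqxx big1 ?add0r => [|j _].
  by rewrite mulrzAr mulr1.
by rewrite (ltn_eqF (ltn_ord j)) mul0rz.
Qed.

Let pf_sum (N : nat) (G : nat -> int -> Af) :
  (forall j, pf (G j)) -> pf (fun t => \sum_(j < N) G j t).
Proof.
move=> Gf; elim: N => [|N IH].
  by exists 0 => t; rewrite big_ord0 peval0.
have [p pE] := pfD IH (Gf N).
by exists p => t; rewrite big_ord_recr -pE.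
Qed.

Let pf_ext g h : (forall t, g t = h t) -> pf h -> pf g.
Proof. by move=> gh [p hp]; exists p => t; rewrite gh. Qed.

Let pf_op n (d : Af -> Af) x : is_diffop (loc_alg i f) n d ->
  pf (fun t => fexp f (- t) * d (fexp f t * x)).
Proof.
elim: n d => [|n IH] d dn.
  exists (polC (d x)) => t; rewrite peval_polC dn.2 mulrA fexpNl mul1r //.
have [p pE] := pfM (frac f 1 1) (IH _ (dn.2 (f%:A_f))).
apply: (@diff_pf (psize p) p) => t; rewrite -[RHS](pE t) /commutator.
have eN : fexp f (- t) = f%:A_f * fexp f (- (t + 1)).
  by rewrite -fexpS opprD addrNK.
have -> : fexp f (t + 1) * x = f%:A_f * (fexp f t * x) by rewrite fexpS mulrA.
rewrite eN -!mulrA [frac f 1 1 * _]mulrCA locfV; ring.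
Qed.


Let pf_act (d : pol D) (v : pol Af) :
  pf (fun t => fexp f (- t) * (peval d t *: (fexp f t * peval v t))).
Proof.
pose G k j t := fexp f (- t) * extop f (d k) (fexp f t * v j) *~ (t ^+ j) *~ (t ^+ k).
apply: (@pf_ext _ (fun t => \sum_(k < psize d) \sum_(j < psize v) G k j t)) => [t|].
  rewrite /peval scaler_suml mulr_sumr; apply: eq_bigr => k _.
  rewrite mulr_sumr scaler_sumr mulr_sumr; apply: eq_bigr => j _.
  by rewrite /G !mulrzAr -scalerMzl -scalerMzr !mulrzAr mulrzAC.
apply: (@pf_sum _ (fun k t => \sum_(j < psize v) G k j t)) => k.
apply: (@pf_sum _ (G k)) => j; apply/pfX/pfX.
by have [n dn] := diffopP (extop f (d k)); apply: pf_op dn.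
Qed.

Let diff_eq0 N c : (forall t : int, \sum_(j < N) c j *~ (t ^+ j) = 0) ->
  forall j, (j < N)%N -> c j = 0.
Proof.
case: N => // N; elim: N c => [|N IH] c c0 j.
  by rewrite ltnS leqn0 => /eqP->; have := c0 0; rewrite big_ord1 mulr1z.
have top : c N.+1 = 0.
  pose b k := \sum_(j < N.+2 | (k < j)%N) c j *+ 'C(j, k).
  have b0 (t : int) : \sum_(k < N.+1) b k *~ (t ^+ k) = 0.
    have e0 : \sum_(j < N.+2) (c j *~ (t + 1) ^+ j - c j *~ t ^+ j) = 0.
      by rewrite sumrB !c0 subrr.
    rewrite -[RHS]e0; under [RHS]eq_bigr do rewrite -mulrzBr binomS mulrz_sumr.
    transitivity (\sum_(j < N.+2) \sum_(k < N.+1 | (k < j)%N) c j *+ 'C(j, k) *~ (t ^+ k)).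
      rewrite [RHS](exchange_big_dep predT) //=; apply: eq_bigr => k _.
      by rewrite mulrz_suml.
    apply: eq_bigr => k _; rewrite (big_ord_narrow (ltn_ord k : (k <= N.+1)%N)) /=.
    by apply: eq_bigr => l _; rewrite -mulr_natl mulrzA natz -pmulrn.
  have := IH b b0 N (ltnSn N); rewrite /b big_mkcond big_ord_recr /= ltnSn.
  rewrite big1 ?add0r => [|l _]; last by rewrite ltnNge -ltnS ltn_ord.
  by rewrite binSn => /mulrn_eq0l.
rewrite ltnS leq_eqVlt => /predU1P[-> //|]; apply: IH => t.
by rewrite -[RHS](c0 t) [RHS]big_ord_recr /= top mul0rz addr0.
Qed.

Lemma Mfs_act_ex (d : pol D) (v : pol Af) : exists w : pol Af,
  forall t, peval w t * fexp f t = peval d t *: (peval v t * fexp f t).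
Proof.
have [w wE] := pf_act d v; exists w => t.
by rewrite -wE mulrAC fexpNl mul1r [X in _ *: X]mulrC.
Qed.

Lemma fexp_inj t (x y : Af) : x * fexp f t = y * fexp f t -> x = y.
Proof.
move=> e; rewrite -[x]mulr1 -[y]mulr1 -(fexpNl f t) mulrCA [RHS]mulrCA.
by rewrite e.
Qed.

Lemma peval_inj (v w : pol Af) : (forall t, peval v t = peval w t) -> v = w.
Proof.
move=> vw; apply/eqP; rewrite -subr_eq0; apply/eqP/polP => n.
pose u := v - w; have [/psizeP//|] := leqP (psize u) n.
apply: (diff_eq0 (c := u)) => t; rewrite -/(peval u t) /u.
by apply: (addIr (peval w t)); rewrite add0r -pevalD subrK vw.
Qed.

End Mfs.

Definition Mfs (K : fieldType) (charK : [pchar K] =i pred0)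
  (A : comPzRingType) (i : {rmorphism K -> A}) (f : A) : Type := pol (loc f).

Section MfsModule.
Variables (K : fieldType) (charK : [pchar K] =i pred0).
Variables (A : comPzRingType) (i : {rmorphism K -> A}) (f : A).

Local Notation M := (Mfs charK i f).
HB.instance Definition _ := GRing.Zmodule.copy M (pol (loc f)).

(* h f^s *)
Definition mul_fs (h : pol (loc f)) : M := h.

(* phi_t (h(s) f^s) = h(t) f^t *)
Definition phi (t : int) (v : M) : loc f := peval (v : pol (loc f)) t * fexp f t.

Lemma phi_inj (v w : M) : (forall t, phi t v = phi t w) -> v = w.
Proof. by move=> vw; apply: (peval_inj charK i) => t; apply/fexp_inj/vw. Qed.

Lemma phiD t (v w : M) : phi t (v + w) = phi t v + phi t w.
Proof. by rewrite /phi pevalD mulrDl. Qed.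

Definition Mfs_act (d : pol (diffop i)) (v : M) : M := sval (cid (Mfs_act_ex charK d v)).

Let phi_act t d v : phi t (Mfs_act d v) = peval d t *: phi t v.
Proof. exact: (svalP (cid (Mfs_act_ex charK d v)) t). Qed.

Let Mfs_actA d e v : Mfs_act d (Mfs_act e v) = Mfs_act (d * e) v.
Proof. by apply: phi_inj => t; rewrite !phi_act pevalM scalerA. Qed.
Let Mfs_act1 : left_id 1 Mfs_act.
Proof. by move=> v; apply: phi_inj => t; rewrite phi_act peval1 scale1r. Qed.
Let Mfs_actDr : right_distributive Mfs_act +%R.
Proof.
by move=> d v w; apply: phi_inj => t; rewrite !(phi_act, phiD) scalerDr.
Qed.
Let Mfs_actDl v : {morph Mfs_act^~ v : d e / d + e}.
Proof.
by move=> d e; apply: phi_inj => t; rewrite !(phi_act, phiD) pevalD scalerDl.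
Qed.
HB.instance Definition _ :=
  GRing.Zmodule_isLmodule.Build (pol (diffop i)) M Mfs_actA Mfs_act1 Mfs_actDr Mfs_actDl.

(* The D_{A|K}[s]-module structure is the one compatible with all the phi_t. *)
Lemma phi_scale t (d : pol (diffop i)) (v : M) : phi t (d *: v) = peval d t *: phi t v.
Proof. exact: phi_act. Qed.

Lemma Mfs_scale_unique (act : pol (diffop i) -> M -> M) :
  (forall t d v, phi t (act d v) = peval d t *: phi t v) ->
  forall d v, act d v = d *: v.
Proof. by move=> actE d v; apply: phi_inj => t; rewrite actE phi_scale. Qed.

End MfsModule.

(* An associative R-algebra: a ring with a central ring morphism from R. *)
Record palg (R : comPzRingType) := Palg {
  palg_ring :> pzRingType;
  palg_in : {rmorphism R -> palg_ring};
  palg_central : forall r b, palg_in r * b = b * palg_in r }.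

Section Tensor.
Variables (R : comPzRingType) (B C : palg R).

Section TensorModule.
Variables (V : lmodType B) (W : lmodType C).

(* Formal sums of pairs (v, w), up to the relations defining V \otimes_R W; no formal
   negatives are needed since - (v \otimes w) = (- v) \otimes w. *)
Inductive tens_rel : seq (V * W) -> seq (V * W) -> Prop :=
| Tens_refl x : tens_rel x x
| Tens_sym x y : tens_rel x y -> tens_rel y x
| Tens_trans x y z : tens_rel x y -> tens_rel y z -> tens_rel x z
| Tens_cat x x' y y' : tens_rel x x' -> tens_rel y y' -> tens_rel (x ++ y) (x' ++ y')
| Tens_catC x y : tens_rel (x ++ y) (y ++ x)
| Tens_0 w : tens_rel [:: (0, w)] [::]
| Tens_Dl v v' w : tens_rel [:: (v + v', w)] [:: (v, w); (v', w)]
| Tens_Dr v w w' : tens_rel [:: (v, w + w')] [:: (v, w); (v, w')]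
| Tens_bal r v w : tens_rel [:: (palg_in B r *: v, w)] [:: (v, palg_in C r *: w)].

Definition tens_eq (x y : seq (V * W)) : bool := `[< tens_rel x y >].

Let tens_eq_refl : reflexive tens_eq.
Proof. by move=> x; apply/asboolP/Tens_refl. Qed.
Let tens_eq_sym : symmetric tens_eq.
Proof. by move=> x y; apply/asboolP/asboolP => /Tens_sym. Qed.
Let tens_eq_trans : transitive tens_eq.
Proof. by move=> y x z /asboolP + /asboolP yz; move=> /Tens_trans/(_ yz) h; apply/asboolP. Qed.

Canonical tens_equiv := EquivRel tens_eq tens_eq_refl tens_eq_sym tens_eq_trans.
Definition tensor := {eq_quot tens_eq}.
HB.instance Definition _ := Choice.on tensor.

Definition tens_class (x : seq (V * W)) : tensor := \pi_tensor x.

Definition tens (v : V) (w : W) : tensor := tens_class [:: (v, w)].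

Lemma tens_classP x y : tens_class x = tens_class y <-> tens_rel x y.
Proof.
split=> [/(@eqmodP _ tens_equiv)/asboolP //|h].
by apply/(@eqmodP _ tens_equiv)/asboolP.
Qed.

Let reprP x : tens_rel (repr (tens_class x)) x.
Proof. by apply/tens_classP; rewrite /tens_class reprK. Qed.

Let class_ind (P : tensor -> Prop) : (forall x, P (tens_class x)) -> forall x, P x.
Proof. by move=> h; apply: quotW. Qed.

Let opps (x : seq (V * W)) := [seq (- p.1, p.2) | p <- x].

Let opps_rel x y : tens_rel x y -> tens_rel (opps x) (opps y).
Proof.
elim=> {x y} /=.
- by move=> x; apply: Tens_refl.
- by move=> x y _; apply: Tens_sym.
- by move=> x y z _ xy _; apply: Tens_trans.
- by move=> x x' y y' _ + _; rewrite /opps !map_cat; apply: Tens_cat.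
- by move=> x y; rewrite /opps !map_cat; apply: Tens_catC.
- by move=> w; rewrite oppr0; apply: Tens_0.
- by move=> v v' w; rewrite opprD; apply: Tens_Dl.
- by move=> v w w'; apply: Tens_Dr.
- by move=> r v w; rewrite -scalerN; apply: Tens_bal.
Qed.

Let addt (x y : tensor) : tensor := tens_class (repr x ++ repr y).
Let oppt (x : tensor) : tensor := tens_class (opps (repr x)).

Let addtE x y : addt (tens_class x) (tens_class y) = tens_class (x ++ y).
Proof. by apply/tens_classP/Tens_cat; apply: reprP. Qed.
Let opptE x : oppt (tens_class x) = tens_class (opps x).
Proof. exact/tens_classP/opps_rel/reprP. Qed.

Let addtA : associative addt.
Proof.
elim/class_ind=> x; elim/class_ind=> y; elim/class_ind=> z.
by rewrite !addtE catA.
Qed.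
Let addtC : commutative addt.
Proof.
elim/class_ind=> x; elim/class_ind=> y.
by rewrite !addtE; apply/tens_classP/Tens_catC.
Qed.
Let add0t : left_id (tens_class [::]) addt.
Proof. by elim/class_ind=> x; rewrite addtE. Qed.
Let addNt : left_inverse (tens_class [::]) oppt addt.
Proof.
elim/class_ind=> x; rewrite opptE addtE; apply/tens_classP.
elim: x => [|[v w] x IH] /=; first exact: Tens_refl.
apply: (@Tens_trans _ ((opps x ++ x) ++ [:: (- v, w); (v, w)])).
  rewrite -cat1s -[(v, w) :: x]cat1s.
  apply: (@Tens_trans _ ([:: (- v, w)] ++ ([:: (v, w)] ++ x) ++ opps x)).
    exact/Tens_cat/Tens_catC/Tens_refl.
  rewrite catA -catA; apply: (@Tens_trans _ (([:: (- v, w); (v, w)]) ++ (x ++ opps x))).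
    exact: Tens_refl.
  apply: (Tens_trans (Tens_catC _ _)); apply: Tens_cat; last exact: Tens_refl.
  exact: Tens_catC.
rewrite -[X in tens_rel _ X]cats0; apply: Tens_cat => //.
apply: (Tens_trans (Tens_sym (Tens_Dl _ _ _))).
by rewrite addNr; apply: Tens_0.
Qed.
HB.instance Definition _ := GRing.isZmodule.Build tensor addtA addtC add0t addNt.

Lemma tens_classD x y : tens_class (x ++ y) = tens_class x + tens_class y.
Proof. by rewrite -addtE. Qed.

Lemma tens_class_sum x : tens_class x = \sum_(p <- x) tens p.1 p.2.
Proof.
elim: x => [|[v w] x IH]; first by rewrite big_nil.
by rewrite big_cons -IH -tens_classD.
Qed.

Lemma tensP (x : tensor) : exists s : seq (V * W), x = \sum_(p <- s) tens p.1 p.2.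
Proof. by exists (repr x); rewrite -tens_class_sum /tens_class reprK. Qed.

Lemma tensDl v v' w : tens (v + v') w = tens v w + tens v' w.
Proof. by rewrite -tens_classD; apply/tens_classP/Tens_Dl. Qed.
Lemma tensDr v w w' : tens v (w + w') = tens v w + tens v w'.
Proof. by rewrite -tens_classD; apply/tens_classP/Tens_Dr. Qed.
Lemma tens_bal r v w : tens (palg_in B r *: v) w = tens v (palg_in C r *: w).
Proof. exact/tens_classP/Tens_bal. Qed.
Lemma tens0l w : tens 0 w = 0.
Proof. exact/tens_classP/Tens_0. Qed.
Lemma tens0r v : tens v 0 = 0.
Proof. by apply: (addrI (tens v 0)); rewrite -tensDr !addr0. Qed.

Section Lift.
Variables (Z : zmodType) (b : V -> W -> Z).
Hypotheses (bDl : forall v v' w, b (v + v') w = b v w + b v' w)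
  (bDr : forall v w w', b v (w + w') = b v w + b v w')
  (bbal : forall r v w, b (palg_in B r *: v) w = b v (palg_in C r *: w)).

Lemma tens_rel_lift x y : tens_rel x y ->
  \sum_(p <- x) b p.1 p.2 = \sum_(p <- y) b p.1 p.2.
Proof.
elim=> {x y} //=.
- by move=> x y z _ -> _ ->.
- by move=> x x' y y' _ e _ e'; rewrite !big_cat /= e e'.
- by move=> x y; rewrite !big_cat /= addrC.
- move=> w; rewrite big_seq1 big_nil /=.
  by apply: (addrI (b 0 w)); rewrite -bDl !addr0.
- by move=> v v' w; rewrite !(big_cons, big_nil) /= bDl !addr0.
- by move=> v w w'; rewrite !(big_cons, big_nil) /= bDr !addr0.
- by move=> r v w; rewrite !big_seq1 /= bbal.
Qed.

Definition tens_lift (x : tensor) : Z := \sum_(p <- repr x) b p.1 p.2.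

Lemma tens_lift_class x : tens_lift (tens_class x) = \sum_(p <- x) b p.1 p.2.
Proof. exact/tens_rel_lift/reprP. Qed.

Lemma tens_liftE v w : tens_lift (tens v w) = b v w.
Proof. by rewrite tens_lift_class big_seq1. Qed.

Lemma tens_liftD x y : tens_lift (x + y) = tens_lift x + tens_lift y.
Proof.
elim/class_ind: x => x; elim/class_ind: y => y.
by rewrite -tens_classD !tens_lift_class big_cat.
Qed.

End Lift.

Lemma tens_ind (P : tensor -> Prop) : (forall v w, P (tens v w)) ->
  (forall x y, P x -> P y -> P (x + y)) -> forall x, P x.
Proof.
move=> Pt PD x; have [s ->] := tensP x.
elim: s => [|p s IH]; first by rewrite big_nil -(tens0l 0).
by rewrite big_cons; apply: PD.
Qed.

End TensorModule.
Arguments tens {V W}.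

(* (b \otimes c) (v \otimes w) = (b v) \otimes (c w) *)
Section Action.
Variables (V : lmodType B) (W : lmodType C).

Let act1 (b : B) (c : C) : tensor V W -> tensor V W :=
  tens_lift (fun v w => tens (b *: v) (c *: w)).

Let act1P b c :
  [/\ forall v w, act1 b c (tens v w) = tens (b *: v) (c *: w)
    & forall x y, act1 b c (x + y) = act1 b c x + act1 b c y].
Proof.
have h1 (v v' : V) (w : W) : tens (b *: (v + v')) (c *: w) =
   tens (b *: v) (c *: w) + tens (b *: v') (c *: w) by rewrite scalerDr tensDl.
have h2 (v : V) (w w' : W) : tens (b *: v) (c *: (w + w')) =
   tens (b *: v) (c *: w) + tens (b *: v) (c *: w') by rewrite scalerDr tensDr.
have h3 r (v : V) (w : W) : tens (b *: (palg_in B r *: v)) (c *: w) =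
   tens (b *: v) (c *: (palg_in C r *: w)).
  by rewrite !scalerA -!palg_central -!scalerA tens_bal.
split=> [v w|x y]; [exact: tens_liftE h1 h2 h3 _ _ | exact: tens_liftD h1 h2 h3 _ _].
Qed.

Definition tens_act (x : tensor B^o C^o) (y : tensor V W) : tensor V W :=
  tens_lift (fun (b : B^o) (c : C^o) => act1 b c y) x.

Let tens_actP y :
  [/\ forall b c, tens_act (tens b c) y = act1 b c y
    & forall x x', tens_act (x + x') y = tens_act x y + tens_act x' y].
Proof.
have h1 (b b' : B^o) (c : C^o) z0 : act1 (b + b') c z0 = act1 b c z0 + act1 b' c z0.
  have [[E1 D1] [E2 D2] [E3 D3]] := And3 (act1P (b + b') c) (act1P b c) (act1P b' c).
  elim/tens_ind: z0 => [v w|x z IHx IHz]; first by rewrite E1 E2 E3 scalerDl tensDl.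
  by rewrite D1 D2 D3 IHx IHz addrACA.
have h2 (b : B^o) (c c' : C^o) z0 : act1 b (c + c') z0 = act1 b c z0 + act1 b c' z0.
  have [[E1 D1] [E2 D2] [E3 D3]] := And3 (act1P b (c + c')) (act1P b c) (act1P b c').
  elim/tens_ind: z0 => [v w|x z IHx IHz]; first by rewrite E1 E2 E3 scalerDl tensDr.
  by rewrite D1 D2 D3 IHx IHz addrACA.
have h3 r (b : B^o) (c : C^o) z0 :
    act1 (palg_in B r *: b) c z0 = act1 b (palg_in C r *: c) z0.
  have [[E1 D1] [E2 D2]] := conj (act1P (palg_in B r *: b) c) (act1P b (palg_in C r *: c)).
  elim/tens_ind: z0 => [v w|x z IHx IHz]; last by rewrite D1 D2 IHx IHz.
  by rewrite E1 E2 -!scalerA tens_bal.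
split=> [b c|x x'].
  exact: (tens_liftE (fun b b' c => h1 b b' c y) (fun b c c' => h2 b c c' y)
    (fun r b c => h3 r b c y)).
exact: (tens_liftD (fun b b' c => h1 b b' c y) (fun b c c' => h2 b c c' y)
    (fun r b c => h3 r b c y)).
Qed.

Lemma tens_actE (b : B^o) (c : C^o) (v : V) (w : W) :
  tens_act (tens b c) (tens v w) = tens ((b : B) *: v) ((c : C) *: w).
Proof. by rewrite (tens_actP _).1 (act1P _ _).1. Qed.

Lemma tens_actDl y : {morph tens_act^~ y : x x' / x + x'}.
Proof. exact: (tens_actP y).2. Qed.

Lemma tens_actDr : right_distributive tens_act +%R.
Proof.
move=> x y y'; elim/tens_ind: x => [b c|x x' IHx IHx'].
  by rewrite !(tens_actP _).1 (act1P _ _).2.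
by rewrite !tens_actDl IHx IHx' addrACA.
Qed.

Lemma tens_act1 : left_id (tens (1 : B^o) (1 : C^o)) tens_act.
Proof.
elim/tens_ind=> [v w|x y IHx IHy]; last by rewrite tens_actDr IHx IHy.
by rewrite tens_actE !scale1r.
Qed.

End Action.

Lemma tens_actA (V : lmodType B) (W : lmodType C) (x y : tensor B^o C^o)
  (z : tensor V W) : tens_act x (tens_act y z) = tens_act (tens_act x y) z.
Proof.
elim/tens_ind: x => [b c|x x' IHx IHx']; last by rewrite !tens_actDl IHx IHx'.
elim/tens_ind: y => [b' c'|y y' IHy IHy'].
  elim/tens_ind: z => [v w|z z' IHz IHz']; last by rewrite !tens_actDr IHz IHz'.
  by rewrite !tens_actE !scalerA.
by rewrite tens_actDl !tens_actDr tens_actDl IHy IHy'.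
Qed.

Definition tens_alg : Type := tensor B^o C^o.
HB.instance Definition _ := GRing.Zmodule.copy tens_alg (tensor B^o C^o).

Let tens_alg_mulr1 : right_id (tens (1 : B^o) (1 : C^o)) (@tens_act B^o C^o).
Proof.
elim/tens_ind=> [b c|x y IHx IHy]; last by rewrite tens_actDl IHx IHy.
by rewrite tens_actE; congr tens; apply: mulr1.
Qed.

HB.instance Definition _ := GRing.Zmodule_isPzRing.Build tens_alg
  (@tens_actA B^o C^o) (@tens_act1 B^o C^o) tens_alg_mulr1
  (fun x y z => tens_actDl z x y) (@tens_actDr B^o C^o).

HB.instance Definition _ (V : lmodType B) (W : lmodType C) :=
  GRing.Zmodule_isLmodule.Build tens_alg (tensor V W)
  (@tens_actA V W) (@tens_act1 V W) (@tens_actDr V W) (@tens_actDl V W).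

End Tensor.

Definition is_ideal (A : comPzRingType) (I : A -> Prop) : Prop :=
  [/\ I 0, forall x y, I x -> I y -> I (x + y) & forall a x, I x -> I (a * x)].

Definition noetherian (A : comPzRingType) : Prop :=
  forall I : A -> Prop, is_ideal I ->
  exists (n : nat) (a : 'I_n -> A),
    forall x, I x <-> exists c : 'I_n -> A, x = \sum_j c j * a j.

Definition finitely_generated_algebra (K A : comPzRingType)
    (i : {rmorphism K -> A}) : Prop :=
  exists (n : nat) (a : 'I_n -> A), forall S : A -> Prop,
    (forall k, S (i k)) -> (forall j, S (a j)) ->
    (forall x y, S x -> S y -> S (x + y)) ->
    (forall x y, S x -> S y -> S (x * y)) -> forall x, S x.

Definition complete_algebra (K A : comPzRingType) (i : {rmorphism K -> A}) : Prop :=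
  exists (d : nat) (p : {rmorphism mpseries K d -> A}),
    (forall k, p (mpsC d k) = i k) /\ (forall a, exists u, p u = a).

Definition finitely_generated (R : pzRingType) (V : lmodType R) : Prop :=
  exists (n : nat) (v : 'I_n -> V),
    forall x, exists c : 'I_n -> R, x = \sum_j c j *: v j.

Definition generated_by (R : pzRingType) (V : lmodType R) (v : V) : Prop :=
  forall x, exists c : R, x = c *: v.

Section BernsteinSato.
Variables (K : fieldType) (charK : [pchar K] =i pred0).
Variables (A : comPzRingType) (i : {rmorphism K -> A}) (f : A).

Definition bernstein_sato_exists : Prop :=
  exists (d : pol (diffop i)) (b : {poly K}), b != 0 /\
    d *: mul_fs charK i (polC (loc_in f f)) = mul_fs charK i (poly_in (loc_alg i f) b).

Lemma Ds_central (p : {poly K}) (d : pol (diffop i)) :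
  poly_in (diffop_in i) p * d = d * poly_in (diffop_in i) p.
Proof.
apply/polP => n; rewrite polME polMrE; apply: eq_bigr => j _.
by rewrite !poly_inE diffop_in_central.
Qed.

Definition Ds : palg {poly K} := Palg Ds_central.
Definition Kfrac : palg {poly K} :=
  @Palg {poly K} {fraction {poly K}} (@tofrac {poly K})
        (fun p r => mulrC (tofrac p) r).

(* D_{A|K}[s] \otimes_{K[s]} K(s) and M^A[f^s] \otimes_{K[s]} K(s) *)
Definition DKs : pzRingType := tens_alg Ds Kfrac.
Definition MKs : lmodType DKs :=
  @tensor {poly K} Ds Kfrac (Mfs charK i f) Kfrac^o.

(* f^s \otimes 1 *)
Definition fs : MKs :=
  @tens {poly K} Ds Kfrac (Mfs charK i f) Kfrac^o (mul_fs charK i 1) 1.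

End BernsteinSato.

(* Main.v *)
Require Import Defs.
From HB Require Import structures.
From mathcomp Require Import all_boot all_order all_algebra boolp.
From mathcomp Require Import zify.

(* Everything rests on shifting s: a relation d(s) . f^a f^s = c(s) f^b f^s holds
   iff all its specializations at integers do, so replacing s by s + k gives
   d(s+k) . f^(a+k) f^s = c(s+k) f^(b+k) f^s.  If f has a Bernstein-Sato
   polynomial, the shifts by -n-1 express each f^(-n-1) f^s through f^(-n) f^s
   over K(s), and every element of M is an A[s]-multiple of some f^(-n) f^s.
   Conversely, finitely many generators are all K(s)-multiples of A[s]-multiples
   of a single f^(-N) f^s; writing f^(-N-1) f^s in terms of it, clearing
   denominators and shifting by N + 1 gives a functional equation. *)

Set Implicit Arguments.
Unset Strict Implicit.
Unset Printing Implicit Defensive.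

Import Order.TTheory GRing.Theory Num.Theory.
Local Open Scope ring_scope.

Local Notation "x %:F" := (@tofrac _ x).

(** * Elements of a fraction field as quotients *)

Lemma fraction_ex (R : idomainType) (w : {fraction R}) :
  exists a b : R, b != 0 /\ w = a%:F / b%:F.
Proof.
elim/quotW: w => r; exists \n_r, \d_r; split; first exact: denom_ratioP.
have d0 : (\d_r)%:F != 0 :> {fraction R} by rewrite tofrac_eq0 denom_ratioP.
apply: (mulIf d0); rewrite mulfVK //.
(* On representatives, (n/d) * (d/1) = n/1 is a cross-multiplied identity in [R]. *)
unlock FracField.tofrac; rewrite -[LHS]FracField.pi_mul.
apply/eqmodP; rewrite /= FracField.equivfE /FracField.mulf.
by rewrite !numden_Ratio ?mulf_neq0 ?oner_neq0 ?denom_ratioP // !mulr1 mulrC.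
Qed.

Lemma mulfV_mull (L : fieldType) (x y : L) : x != 0 -> x * (x * y)^-1 = y^-1.
Proof. by move=> x0; rewrite invfM mulVKf. Qed.

(** * Tensor products with K(s): common denominators and torsion *)

Section Clearing.
Variables (K : fieldType) (B : palg {poly K}) (V : lmodType B).

Local Notation F := (Kfrac K).
Local Notation T := (@tensor _ B F V F^o).
Implicit Types (c e : {poly K}) (w : {fraction {poly K}}) (v : V).

Lemma tens_balF c v w :
  tens (palg_in B c *: v) (w : F^o) = tens v (c%:F * w : F^o).
Proof. exact: tens_bal. Qed.

(** Numerators move into the left factor, and fractions over [c] and [c'] add up over [c * c']. *)
Lemma tens_frac (x : T) : exists v c, c != 0 /\ x = tens v (c%:F^-1 : F^o).
Proof.
elim/tens_ind: x => [v w|_ _ [v [c [c0 ->]]] [v' [c' [c0' ->]]]].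
  have [a [b [b0 ->]]] := fraction_ex w.
  by exists (palg_in B a *: v), b; split=> //; rewrite tens_balF.
exists (palg_in B c' *: v + palg_in B c *: v'), (c * c').
rewrite mulf_neq0 // tensDl !tens_balF tofracM /=; split=> //.
have cF (e : {poly K}) : e != 0 -> e%:F != 0 :> {fraction {poly K}}.
  by rewrite tofrac_eq0.
congr (tens v _ + tens v' _); last by rewrite mulfV_mull ?cF.
by rewrite [c%:F * _]mulrC mulfV_mull ?cF.
Qed.

(* The element of [{poly K}] equal to [c w] if there is one, else the junk value [0]. *)
Definition fnum c w : {poly K} :=
  if pselect (exists a, c%:F * w = a%:F) is left h then sval (cid h) else 0.

Lemma fnumE c w a : c%:F * w = a%:F -> fnum c w = a.
Proof.
move=> e; rewrite /fnum; case: pselect => [h|[]]; last by exists a.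
by case: cid => b /= eb; apply/eqP; rewrite -tofrac_eq -eb e.
Qed.

Definition clears c (x : seq (V * F^o)) : Prop :=
  forall p, p \in map snd x -> exists a, c%:F * (p : {fraction _}) = a%:F.

(** When [c] clears [x], this is the numerator: [c] times the class of [x] equals [fnum_sum c x]
    tensored with 1. *)
Definition fnum_sum c (x : seq (V * F^o)) : V :=
  \sum_(p <- x) palg_in B (fnum c p.2) *: p.1.

Lemma clearsM c e x : clears c x -> clears (e * c) x.
Proof.
by move=> cx p /cx[a ea]; exists (e * a); rewrite !tofracM -mulrA ea.
Qed.

Lemma clears_cat c x y : clears c (x ++ y) <-> clears c x /\ clears c y.
Proof.
rewrite /clears map_cat; split=> [h|[hx hy] p].
  by split=> p px; apply: h; rewrite mem_cat px ?orbT.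
by rewrite mem_cat => /orP[/hx|/hy].
Qed.

Lemma clears_cons c v w x :
  clears c ((v, w : F^o) :: x) <-> (exists a, c%:F * w = a%:F) /\ clears c x.
Proof.
split=> [h|[hw hx] p].
  by split=> [|p px]; apply: h; rewrite inE ?eqxx ?px ?orbT.
by rewrite inE => /predU1P[->|/hx].
Qed.

Lemma clears_ex x : exists2 c, c != 0 & clears c x.
Proof.
elim: x => [|[v w] x [c c0 cx]]; first by exists 1; rewrite ?oner_neq0.
have [a [b [b0 ew]]] := fraction_ex w.
exists (c * b); first by rewrite mulf_neq0.
apply/clears_cons; split; last by rewrite mulrC; apply: clearsM.
exists (c * a); rewrite !tofracM ew -mulrA; congr (_ * _).
by rewrite mulrC mulfVK // tofrac_eq0.
Qed.

(** If only [e * c] cleared [x], some [fnum c] could be the junk 0; hence the hypothesis on [c]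
    itself. *)
Lemma fnum_sumM c e x : clears c x ->
  fnum_sum (e * c) x = palg_in B e *: fnum_sum c x.
Proof.
elim: x => [|[v w] x IH]; first by rewrite /fnum_sum !big_nil scaler0.
move=> /clears_cons[[a ea] /IH{}IH]; rewrite /fnum_sum !big_cons scalerDr.
congr (_ + _); last exact: IH.
rewrite /= (fnumE ea) (@fnumE _ _ (e * a)); first by rewrite rmorphM scalerA.
by rewrite !tofracM -mulrA ea.
Qed.

Lemma fnum_sum_cat c x y : fnum_sum c (x ++ y) = fnum_sum c x + fnum_sum c y.
Proof. exact: big_cat. Qed.

(* Multiplying by a common denominator turns an equality of formal sums into an
   equality in [V]; a multiple may be needed at each transitivity step. *)
Lemma tens_rel_clear (x y : seq (V * F^o)) : tens_rel x y ->
  exists c, [/\ c != 0, clears c x, clears c y & fnum_sum c x = fnum_sum c y].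
Proof.
elim=> {x y}.
- by move=> x; have [c c0 cx] := clears_ex x; exists c.
- by move=> x y _ [c [c0 cx cy e]]; exists c.
- move=> x y z _ [c [c0 cx cy e]] _ [c' [c0' cy' cz e']].
  exists (c' * c); rewrite mulf_neq0 //; split=> //; first exact: clearsM.
    by rewrite mulrC; apply: clearsM.
  by rewrite fnum_sumM // e -fnum_sumM // mulrC fnum_sumM // e' -fnum_sumM.
- move=> x x' y y' _ [c [c0 cx cx' e]] _ [c' [c0' cy cy' e']].
  exists (c' * c); rewrite mulf_neq0 // !fnum_sum_cat.
  split=> //; try by apply/clears_cat; split; [|rewrite mulrC]; apply: clearsM.
  rewrite fnum_sumM // e -fnum_sumM //; congr (_ + _).
  by rewrite mulrC !fnum_sumM // e'.
- move=> x y; have [c c0 /clears_cat[cx cy]] := clears_ex (x ++ y).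
  exists c; rewrite !fnum_sum_cat addrC; split=> //; exact/clears_cat.
- move=> w; have [c c0 cw] := clears_ex [:: (0, w)].
  by exists c; rewrite /fnum_sum big_seq1 big_nil scaler0.
- move=> v v' w; have [c c0 cw] := clears_ex [:: (v, w)].
  move: (cw) => /clears_cons[w0 _].
  exists c; rewrite /fnum_sum !big_cons big_nil /= !addr0 scalerDr.
  by split=> //; do 2![apply/clears_cons; split=> //].
- move=> v w w'; have [c c0] := clears_ex [:: (v, w); (v, w')].
  move=> cw; move: (cw) => /clears_cons[[a ea] /clears_cons[[a' ea'] _]].
  have es : c%:F * (w + w' : {fraction _}) = (a + a')%:F.
    by rewrite mulrDr tofracD ea ea'.
  exists c; rewrite /fnum_sum !big_cons big_nil /= !addr0.
  rewrite (fnumE es) (fnumE ea) (fnumE ea') rmorphD scalerDl; split=> //.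
  by apply/clears_cons; split=> //; exists (a + a').
move=> r v w; have [c c0 cw] := clears_ex [:: (v, w)].
move: cw => /clears_cons[[a ea] _].
have er : c%:F * (palg_in F r *: w : {fraction _}) = (a * r)%:F.
  by rewrite -[palg_in F r *: w]/(r%:F * w) mulrCA ea tofracM mulrC.
exists c; rewrite /fnum_sum !big_cons big_nil /= !addr0.
rewrite (fnumE ea) (fnumE er) rmorphM scalerA.
by split=> //; apply/clears_cons; split=> //; [exists a|exists (a * r)].
Qed.

(** The kernel of the map from [V] to its localization is torsion: clearing by [c] turns the
    singleton [(v, 1)] into [c] times [v], as [fnum c 1 = c]. *)
Lemma tens1_eq v v' : tens v (1 : F^o) = tens v' (1 : F^o) ->
  exists2 c, c != 0 & palg_in B c *: v = palg_in B c *: v'.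
Proof.
move=> /tens_classP/tens_rel_clear[c [c0 _ _]].
by rewrite /fnum_sum !big_seq1 /= (@fnumE c 1 c) ?mulr1 //; exists c.
Qed.

End Clearing.

(** * Integer values of polynomials and the substitution of s + k for s *)

Section PolEvaluation.
Variable R : pzRingType.

Definition polX : pol R := mkpol 2 (fun n => (n == 1%N)%:R).

Lemma peval_polX t : peval polX t = t%:~R.
Proof. by rewrite peval_mkpol !big_ord_recl big_ord0 /= mul0rz add0r addr0 expr1. Qed.

Lemma pevalXn (u : pol R) n t : peval (u ^+ n) t = peval u t ^+ n.
Proof.
elim: n => [|n IH]; first by rewrite !expr0 peval1.
by rewrite !exprS pevalM IH.
Qed.

Lemma pol_shift_ex (u : pol R) (k : int) :
  exists u' : pol R, forall t, peval u' t = peval u (t + k).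
Proof.
exists (\sum_(j < psize u) polC (u j) * (polX + polC k%:~R) ^+ j) => t.
rewrite (big_morph (fun v : pol R => peval v t) (fun v w => pevalD v w t) (@peval0 R t)).
apply: eq_bigr => j _.
rewrite pevalM pevalXn pevalD !peval_polC peval_polX -intrD -rmorphXn /=.
by rewrite mulrzr.
Qed.

Lemma peval_poly_in (K : nzRingType) (i : {rmorphism K -> R}) p t :
  peval (poly_in i p) t = i p.[t%:~R].
Proof.
rewrite peval_mkpol horner_coef rmorph_sum; apply: eq_bigr => j _.
by rewrite rmorphM -rmorphXn /= rmorph_int mulrzr.
Qed.

End PolEvaluation.

(** Over a domain, composing a nonzero polynomial with one of degree 1 cannot give 0. *)
Lemma poly_shift_ex (K : idomainType) (p : {poly K}) (k : int) : p != 0 ->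
  exists2 q, q != 0 & forall t : int, q.[t%:~R] = p.[(t + k)%:~R].
Proof.
move=> p0; exists (p \Po ('X + k%:~R%:P)).
  by rewrite comp_poly2_eq0 // size_XaddC.
by move=> t; rewrite horner_comp !hornerE intrD.
Qed.

(** * Integer powers of f in the localization *)

Section Powers.
Variables (A : comPzRingType) (f : A).

Lemma fexp1 : fexp f 1 = loc_in f f.
Proof. by rewrite -[1]add0r fexpS fexp0 mulr1. Qed.

Lemma fexpD a b : fexp f (a + b) = fexp f a * fexp f b.
Proof.
elim: b => [|n IH|n IH]; first by rewrite addr0 mulr1.
  by rewrite -addn1 PoszD addrA !fexpS IH mulrCA.
(* Multiplication by f is injective and raises the exponent -n-1 to -n. *)
apply: (@locf_inj _ f); rewrite mulrCA -!fexpS -addrA.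
by rewrite (_ : - n.+1%:Z + 1 = - n%:Z) ?IH //; lia.
Qed.

Lemma frac_fexp a n : Defs.frac f a n = loc_in f a * fexp f (- n%:Z).
Proof. by rewrite fracE; congr (_ * _); case: n => [|n] //; rewrite -NegzE. Qed.

Lemma loc_in_fexp n : loc_in f (f ^+ n) = fexp f n.
Proof. by []. Qed.

Lemma mulop_locE (K : comPzRingType) (i : {rmorphism K -> A}) a (x : loc f) :
  mulop i a *: x = loc_in f a * x.
Proof. by rewrite -[LHS]/(extop f (mulop i a) x) extop_mul. Qed.

End Powers.

(** * Functional equations between the elements f^a f^s *)

Section Functional.
Variables (K : fieldType) (charK : [pchar K] =i pred0).
Variables (A : comPzRingType) (i : {rmorphism K -> A}) (f : A).

Local Notation M := (Mfs charK i f).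
Local Notation cst := (palg_in (Ds i)).

(* [fpow a] is [f^a f^s]. *)
Definition fpow (a : int) : M := mul_fs charK i (polC (fexp f a)).

Lemma phi_fpow t a : phi t (fpow a) = fexp f (t + a).
Proof. by rewrite /phi peval_polC -fexpD addrC. Qed.

Lemma phi_cst t c (v : M) : phi t (cst c *: v) = loc_alg i f c.[t%:~R] * phi t v.
Proof. by rewrite phi_scale peval_poly_in /diffop_in mulop_locE. Qed.

Lemma mul_fs1 : mul_fs charK i 1 = fpow 0.
Proof. by apply: phi_inj => t; rewrite phi_fpow addr0 /phi peval1 mul1r. Qed.

Lemma mul_fs_cst b : mul_fs charK i (poly_in (loc_alg i f) b) = cst b *: fpow 0.
Proof.
apply: phi_inj => t; rewrite phi_cst phi_fpow addr0 /phi.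
by rewrite peval_poly_in.
Qed.

(** The shifted identity at s = t is the given one at s = t + k, because [phi t (fpow (a + k))]
    equals [phi (t + k) (fpow a)]. *)
Lemma functional_shift (d : Ds i) c a b k : c != 0 ->
  d *: fpow a = cst c *: fpow b ->
  exists (d' : Ds i) c', c' != 0 /\ d' *: fpow (a + k) = cst c' *: fpow (b + k).
Proof.
move=> c0 e; have [d' d'E] := pol_shift_ex (d : pol (diffop i)) k.
have [c' c'0 c'E] := poly_shift_ex k c0.
exists d', c'; split=> //; apply: phi_inj => t.
have /(congr1 (@phi _ _ _ _ _ (t + k))) := e.
rewrite phi_scale phi_cst phi_scale phi_cst d'E c'E !phi_fpow.
by rewrite -!addrA ![k + _]addrC.
Qed.

Lemma bernstein_sato_fpow : bernstein_sato_exists charK i f <->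
  exists (d : Ds i) c, c != 0 /\ d *: fpow 1 = cst c *: fpow 0.
Proof.
split=> -[d [c [c0 e]]]; exists d, c; split=> //.
  by rewrite -mul_fs_cst -e /fpow fexp1.
by rewrite mul_fs_cst -e /fpow fexp1.
Qed.

(** The operator is multiplication by f^(n-m); thus the submodules generated by f^(-n) f^s increase
    with n. *)
Lemma fpow_leq (m n : nat) : (m <= n)%N ->
  exists d : Ds i, fpow (- m%:Z) = d *: fpow (- n%:Z).
Proof.
move=> /subnK mn; exists (polC (mulop i (f ^+ (n - m)))); apply: phi_inj => t.
rewrite phi_scale peval_polC mulop_locE !phi_fpow loc_in_fexp -fexpD.
by congr (fexp f _); lia.
Qed.

Lemma mul_fs_polC_frac a n :
  mul_fs charK i (polC (Defs.frac f a n)) = polC (mulop i a) *: fpow (- n%:Z).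
Proof.
apply: phi_inj => t; rewrite phi_scale peval_polC mulop_locE phi_fpow.
by rewrite /phi peval_polC frac_fexp -mulrA -fexpD addrC.
Qed.

Lemma Mfs_sum (v : M) : v = \sum_(j < psize (v : pol (loc f)))
  (polX (diffop i) ^+ j : Ds i) *: mul_fs charK i (polC ((v : pol (loc f)) j)).
Proof.
apply: phi_inj => t.
have phi0 : phi t (0 : M) = 0 by rewrite /phi peval0 mul0r.
rewrite (big_morph (phi t) (phiD t) phi0).
rewrite /phi /peval mulr_suml; apply: eq_bigr => j _.
rewrite -[X in _ = X]/(phi t (_ *: _)) phi_scale pevalXn peval_polX.
rewrite /phi peval_polC -rmorphXn /= scaler_int.
by rewrite mulrzAl.
Qed.

(** The finitely many coefficients of [v] share a power of f as denominator. Allowing every larger n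
    lets several bounds be merged by a maximum. *)
Lemma Mfs_denominator (v : M) : exists N, forall n, (N <= n)%N ->
  exists d : Ds i, v = d *: fpow (- n%:Z).
Proof.
(* The induction is on the number of summands, with the coefficients of [v] fixed. *)
rewrite [v]Mfs_sum; elim: (psize _) => [|N [m IH]].
  by exists 0%N => n _; exists 0; rewrite big_ord0 scale0r.
have [a [k vN]] : exists a k, (v : pol (loc f)) N = Defs.frac f a k.
  by elim/loc_ind: ((v : pol (loc f)) N) => a k; exists a, k.
exists (maxn m k) => n.
rewrite geq_max => /andP[/IH[d e] /fpow_leq[d' e']].
eexists; rewrite big_ord_recr /= e vN mul_fs_polC_frac e'.
by rewrite !scalerA -scalerDl.
Qed.

End Functional.

(** * Generators over K(s) and the three implications *)

Section Generation.
Variables (K : fieldType) (charK : [pchar K] =i pred0).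
Variables (A : comPzRingType) (i : {rmorphism K -> A}) (f : A).

Local Notation F := (Kfrac K).
Local Notation M := (Mfs charK i f).
Local Notation MK := (MKs charK i f).
Local Notation DK := (DKs i).
Local Notation cst := (palg_in (Ds i)).
Local Notation fpow := (fpow charK i f).

(** Pure tensors typed in [DK] and [MK], so that [*:] between them is the action of the ring
    [DK]. *)
Definition DKten (d : Ds i) (u : {fraction {poly K}}) : DK :=
  @tens _ (Ds i) F (Ds i)^o F^o d u.
Definition MKten (v : M) (w : {fraction {poly K}}) : MK :=
  @tens _ (Ds i) F M F^o v w.

Lemma DKten_scale d u v w : DKten d u *: MKten v w = MKten (d *: v) (u * w).
Proof. exact: (@tens_actE _ (Ds i) F M F^o d u v w). Qed.

Lemma MKten_frac (x : MK) : exists v c, c != 0 /\ x = MKten v (c%:F^-1).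
Proof. exact: (@tens_frac K (Ds i) M x). Qed.

Lemma DKten_frac (x : DK) : exists d c, c != 0 /\ x = DKten d (c%:F^-1).
Proof. exact: (@tens_frac K (Ds i) (Ds i)^o x). Qed.

Lemma MKten_cst c v w : MKten (cst c *: v) w = MKten v (c%:F * w).
Proof. exact: (@tens_balF K (Ds i) M). Qed.

Lemma fsE : fs charK i f = MKten (fpow 0) 1.
Proof. by rewrite -mul_fs1. Qed.

Lemma generated_denominator (x : MK) : exists N, forall n, (N <= n)%N ->
  exists C : DK, x = C *: MKten (fpow (- n%:Z)) 1.
Proof.
have [v [c [_ ->]]] := MKten_frac x; have [N vN] := Mfs_denominator v.
exists N => n /vN[d ->]; exists (DKten d c%:F^-1).
by rewrite DKten_scale mulr1.
Qed.

Lemma bernstein_sato_generated :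
  bernstein_sato_exists charK i f -> generated_by (fs charK i f).
Proof.
move=> /bernstein_sato_fpow[d [c [c0 e]]] x.
have [N /(_ _ (leqnn N))[C ->]] := generated_denominator x.
suff [C' ->] : exists C' : DK, MKten (fpow (- N%:Z)) 1 = C' *: fs charK i f.
  by exists (C * C'); rewrite scalerA.
rewrite fsE; elim: N {C} => [|n [C' IH]]; first by exists 1; rewrite scale1r oppr0.
have [d' [c' [c'0]]] := functional_shift (- n.+1%:Z) c0 e.
rewrite (_ : 1 + - n.+1%:Z = - n%:Z) ?add0r; last by lia.
(* Since c' is invertible in K(s), [e'] gives f^(-n-1) f^s as [DKten d' c'%:F^-1] applied to f^(-n)
   f^s. *)
move=> e'; exists (DKten d' c'%:F^-1 * C').
rewrite -scalerA -IH DKten_scale mulr1 e' MKten_cst mulfV //.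
by rewrite tofrac_eq0.
Qed.

Lemma generated_finitely :
  generated_by (fs charK i f) -> finitely_generated MK.
Proof.
move=> h; exists 1%N, (fun=> fs charK i f) => x; have [C ->] := h x.
by exists (fun=> C); rewrite big_ord1.
Qed.

(** With N the largest denominator exponent of the generators, f^(-N) f^s generates all of them, so
    the module is cyclic. *)
Lemma finitely_generated_fpow : finitely_generated MK ->
  exists N, forall x : MK, exists C : DK, x = C *: MKten (fpow (- N%:Z)) 1.
Proof.
move=> [n [v vgen]].
have [N vN] : exists N, forall j, exists C : DK, v j = C *: MKten (fpow (- N%:Z)) 1.
  have [N NP] := choice (fun j => generated_denominator (v j)).
  by exists (\max_j N j) => j; apply: NP; apply: leq_bigmax.
have [C CE] := choice vN.
exists N => x; have [c ->] := vgen x; exists (\sum_j c j * C j).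
by rewrite scaler_suml; apply: eq_bigr => j _; rewrite -scalerA -CE.
Qed.

Lemma finitely_generated_bernstein_sato :
  finitely_generated MK -> bernstein_sato_exists charK i f.
Proof.
(* The test element has one more f in the denominator than the generator. *)
move=> /finitely_generated_fpow[N /(_ (MKten (fpow (- N.+1%:Z)) 1))[C e]].
have [d [c [c0 eC]]] := DKten_frac C.
have e1 : MKten (cst c *: fpow (- N.+1%:Z)) 1 = MKten (d *: fpow (- N%:Z)) 1.
  rewrite MKten_cst mulr1 -[c%:F]mulr1 -[fpow (- N.+1%:Z)]scale1r -DKten_scale.
  by rewrite e eC !DKten_scale mulr1 scale1r mulfV // tofrac_eq0.
(* Returning from K(s) to M costs a torsion factor [q], absorbed into both sides. *)
have [q q0 e2] := tens1_eq e1.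
apply/bernstein_sato_fpow.
have e3 : (cst q * d) *: fpow (- N%:Z) = cst (q * c) *: fpow (- N.+1%:Z).
  by rewrite rmorphM -!scalerA.
(* This shift sends the exponents -N and -N-1 to 1 and 0, as in the Bernstein-Sato equation. *)
have [d' [c' [c'0]]] := functional_shift (N.+1%:Z) (mulf_neq0 q0 c0) e3.
rewrite addNr (_ : - N%:Z + N.+1%:Z = 1); last by lia.
by exists d', c'.
Qed.

End Generation.

Theorem proposition2p18 (K : fieldType) (charK : [pchar K] =i pred0)
    (A : comPzRingType) (iota : {rmorphism K -> A})
    (noethA : noetherian A)
    (hA : finitely_generated_algebra iota \/ complete_algebra iota)
    (f : A) :
  (bernstein_sato_exists charK iota f <->
     finitely_generated (MKs charK iota f)) /\
  (finitely_generated (MKs charK iota f) <->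
     generated_by (fs charK iota f)).
Proof.
have h13 := @bernstein_sato_generated _ charK _ iota f.
have h32 := @generated_finitely _ charK _ iota f.
have h21 := @finitely_generated_bernstein_sato _ charK _ iota f.
by split; split; auto.
Qed.
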